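(* Let $A$ be an operator space in $\mathbb{B}(\mathcal{H})$ and let $T : A \times A \longrightarrow \mathbb{C}$ be a bilinear form. Then the following are equivalent: (1) $\|T\|_{wh^*} \le 1$. (2) There exists a state $p_0$ on $C^*(A)$ such that $|T(x,y)| \le p_0(xx^* )^{1/2}\, p_0(y^*y)^{1/2}$ for all $x,y \in A$. (3) There exist a $*$-representation $\pi : C^*(A) \longrightarrow \mathbb{B}(\mathcal{K})$ on a Hilbert space $\mathcal{K}$, a unit vector $\xi \in \mathcal{K}$ and a contraction $b \in \mathbb{B}(\mathcal{K})$ such that $T(x,y) = (\pi(x)\, b\, \pi(y)\xi \mid \xi)$ for all $x,y\in A$. (4) There exist an extension $T' : C^*(A) \longrightarrow C^*(A)^*$ of $T$, a Hilbert space $\mathcal{K}$, and completely bounded maps $a : C^*(A) \longrightarrow \mathcal{K}_c$ and $b : \mathcal{K}_c \longrightarrow \mathcal{K}_c$ such that $T' = a^* b a$ and $\|a\|_{cb}^2\, \|b\|_{cb} \le 1$.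
   Context: $\mathbb{B}(\mathcal{H})$ is the algebra of bounded operators on a Hilbert space $\mathcal{H}$; an operator space $A$ in $\mathbb{B}(\mathcal{H})$ is a linear subspace with the inherited matrix norms, and $C^*(A)$ is the $C^*$-algebra in $\mathbb{B}(\mathcal{H})$ generated by $A$. Inner products $(\cdot\mid\cdot)$ are linear in the first variable. The numerical radius Haagerup norm of $u$ in the algebraic tensor product $A \otimes A$ is $$\|u\|_{wh} = \inf\Big\{ \tfrac12 \big\|[x_1,\dots,x_n,y_1^*,\dots,y_n^*]\big\|^2 \;\Big|\; u=\sum_{i=1}^n x_i\otimes y_i,\ x_i,y_i\in A\Big\},$$ where $[x_1,\dots,x_n,y_1^*,\dots,y_n^*]$ is a row in $M_{1,2n}(C^*(A))$, so that $\|[x_1,\dots,x_n,y_1^*,\dots,y_n^*]\|^2=\|\sum_i (x_ix_i^*+y_i^*y_i)\|$. A bilinear form $T$ on $A\times A$ is identified with the linear form on $A\otimes A$ given by $x\otimes y\mapsto T(x,y)$, and with the linear map $T$ from $A$ to its dual given by $\langle x, T(y)\rangle = T(x,y)$. $\|T\|_{wh^*}$ is the norm of the linear form $T$ when $A\otimes A$ carries the norm $\|\cdot\|_{wh}$ (so $\|T\|_{wh^*}\le 1$ means $|T(u)|\le\|u\|_{wh}$ for all $u\in A\otimes A$). A linear map $T':C^*(A)\to C^*(A)^*$ is an extension of $T$ if $\langle x,T'(y)\rangle = T(x,y)$ for all $x,y\in A$. $\mathcal{K}_c$ is the column Hilbert space: $\mathcal{K}$ with the operator space structure in which, for $\xi=[\xi_{ij}]\in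 M_n(\mathcal{K})$, $\|\xi\|_c$ is the operator norm of $\mathbb{C}^n\ni[\lambda_1,\dots,\lambda_n]\mapsto [\sum_{j}\lambda_j\xi_{ij}]_i\in\mathcal{K}^n$. For a completely bounded map $a:C^*(A)\to\mathcal{K}_c$, the map $a^*:\mathcal{K}_c\to C^*(A)^*$ is defined by $\langle a^*(\eta),x\rangle = (\eta\mid a(x^* ))$ for $\eta\in\mathcal{K}$, $x\in C^*(A)$. $\|\cdot\|_{cb}$ is the completely bounded norm. *)

(* Defs.v *)
From HB Require Import structures.
From mathcomp Require Import all_boot all_order all_algebra.
From mathcomp Require Import sesquilinear complex.
From mathcomp Require Import all_classical all_reals all_analysis.

Set Implicit Arguments.
Unset Strict Implicit.
Unset Printing Implicit Defensive.

Import Order.TTheory GRing.Theory Num.Theory.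
Import numFieldNormedType.Exports.

Local Open Scope classical_set_scope.
Local Open Scope ring_scope.

HB.mixin Record isHilbert (R : realType) H & CompleteNormedModule R[i] H := {
  inner : {dot H for (@Num.conj R[i])} ;
  inner_norm : forall x : H, inner x x = `|x| ^+ 2
}.

#[short(type="hilbertType")]
HB.structure Definition Hilbert (R : realType) :=
  {H of CompleteNormedModule R[i] H & isHilbert R H}.

Section RealNorm.
Variables (R : realType) (U : normedModType R[i]).
Implicit Types x y : U.

(* The norm of a normedModType over R[i] takes (nonnegative real) values in
   R[i]; rnorm is the same norm with values in R. *)
Definition rnorm x : R := complex.Re `|x|.

Lemma rnormE x : `|x| = (rnorm x)%:C%C.
Proof. by rewrite /rnorm RRe_real. Qed.

Lemma rnorm_ge0 x : 0 <= rnorm x.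
Proof. by rewrite -ler0c -rnormE. Qed.

Lemma rnormD x y : rnorm (x + y) <= rnorm x + rnorm y.
Proof. by rewrite -lecR rmorphD /= -!rnormE ler_normD. Qed.

Lemma rnormZ (a : R[i]) x : rnorm (a *: x) = complex.Re `|a| * rnorm x.
Proof.
apply: complexI; rewrite rmorphM -!rnormE normrZ.
by congr (_ * _); exact: rnormE.
Qed.

Lemma rnorm0 : rnorm 0 = 0.
Proof. by rewrite /rnorm normr0. Qed.

Lemma rnorm_eq0 x : rnorm x = 0 -> x = 0.
Proof. by move=> x0; apply/normr0_eq0; rewrite rnormE x0. Qed.

End RealNorm.

(* The norm of a linear map f for the norms nX and nY. As sup is 0 on unbounded
   sets, it is meaningful only when f is bounded. *)
Definition map_norm (R : realType) (X Y : Type) (nX : X -> R) (nY : Y -> R)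
    (f : X -> Y) : R :=
  sup [set nY (f x) | x in [set x | nX x <= 1]].

Section BoundedLinear.
Variables (R : realType) (V W : normedModType R[i]).

Definition bounded_linear : {pred V -> W} := fun f =>
  `[< linear f /\ exists M : R, forall x, rnorm (f x) <= M * rnorm x >].

Lemma bounded_linear_submod_closed : submod_closed bounded_linear.
Proof.
split=> [|a f g /asboolP[lf [M Mf]] /asboolP[lg [N Ng]]]; apply/asboolP; split.
- by move=> a x y /=; rewrite /GRing.zero /= scaler0 addr0.
- by exists 0 => x; rewrite mul0r /GRing.zero /= rnorm0.
- move=> b x y; rewrite !fctE/= lf lg !scalerDr !scalerA mulrC.
  by rewrite addrACA.
- exists (complex.Re `|a| * M + N) => x.
  rewrite !fctE /= (le_trans (rnormD _ _))// mulrDl lerD// rnormZ -mulrA.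
  by rewrite ler_wpM2l// -ler0c RRe_real.
Qed.

HB.instance Definition _ := GRing.isSubmodClosed.Build R[i] (V -> W)
  bounded_linear bounded_linear_submod_closed.

Record blin := Blin {
  blin_fun :> V -> W ;
  blinP : blin_fun \in bounded_linear
}.
HB.instance Definition _ := [isSub of blin for blin_fun].
HB.instance Definition _ := [Choice of blin by <:].
HB.instance Definition _ := [SubChoice_isSubLmodule of blin by <:].

Implicit Types f g : blin.

Lemma blin_linear f : linear f.
Proof. by have /asboolP[] := valP f. Qed.

Lemma blin_bounded f : exists M : R, forall x, rnorm (f x) <= M * rnorm x.
Proof. by have /asboolP[] := valP f. Qed.

Lemma blin0 f : f 0 = 0.
Proof. by have := blin_linear f (-1) 0 0; rewrite scaler0 addr0 scaleN1r addNr. Qed.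

Lemma blinZ f a x : f (a *: x) = a *: f x.
Proof. by have := blin_linear f a x 0; rewrite blin0 !addr0. Qed.

Lemma blin_ext f g : f =1 g -> f = g.
Proof. by move=> fg; apply/val_inj/funext. Qed.

Definition opnorm f : R := map_norm (@rnorm R V) (@rnorm R W) f.

Lemma opnorm_has_sup f :
  has_sup [set rnorm (f x) | x in [set x : V | rnorm x <= 1]].
Proof.
split; first by exists (rnorm (f 0)); exists 0 => //=; rewrite rnorm0.
have [M fM] := blin_bounded f; exists `|M| => _ [x /= x1 <-].
rewrite (le_trans (fM x))// (le_trans (ler_norm _))// normrM.
by rewrite ler_piMr// ger0_norm// rnorm_ge0.
Qed.

Lemma opnorm_ge0 f : 0 <= opnorm f.
Proof.
rewrite (le_trans (rnorm_ge0 (f 0)))//; apply: sup_upper_bound.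
  exact: opnorm_has_sup.
by exists 0 => //=; rewrite rnorm0.
Qed.

Lemma le_opnorm f x : rnorm (f x) <= opnorm f * rnorm x.
Proof.
have [/rnorm_eq0 ->|x0] := eqVneq (rnorm x) 0; first by rewrite blin0 !rnorm0 mulr0.
have xgt0 : 0 < rnorm x by rewrite lt0r x0 rnorm_ge0.
have Re1 : complex.Re `|((rnorm x)^-1)%:C%C| = (rnorm x)^-1 :> R.
  by rewrite ger0_norm// ler0c invr_ge0 rnorm_ge0.
rewrite -ler_pdivrMr// mulrC -Re1 -rnormZ -blinZ.
apply: sup_upper_bound; first exact: opnorm_has_sup.
exists (((rnorm x)^-1)%:C%C *: x) => //=.
by rewrite rnormZ Re1 mulVf.
Qed.

Lemma opnorm_le f M : 0 <= M -> (forall x, rnorm (f x) <= M * rnorm x) ->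
  opnorm f <= M.
Proof.
move=> M0 fM; apply: ge_sup; first by have [] := opnorm_has_sup f.
by move=> _ [x /= x1 <-]; rewrite (le_trans (fM x))// ler_piMr.
Qed.

Definition blin_norm f : R[i] := (opnorm f)%:C%C.

Lemma blin_normD f g : blin_norm (f + g) <= blin_norm f + blin_norm g.
Proof.
rewrite -rmorphD lecR; apply: opnorm_le => [|x].
  by rewrite addr_ge0 ?opnorm_ge0.
by rewrite (le_trans (rnormD _ _))// mulrDl lerD// le_opnorm.
Qed.

Lemma opnormZ_le a f : opnorm (a *: f) <= complex.Re `|a| * opnorm f.
Proof.
apply: opnorm_le => [|x].
  by rewrite mulr_ge0 ?opnorm_ge0// -ler0c RRe_real.
rewrite [_ x]/(a *: f x) rnormZ -mulrA ler_wpM2l ?le_opnorm//.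
by rewrite -ler0c RRe_real.
Qed.

Lemma blin_normZ a f : blin_norm (a *: f) = `|a| * blin_norm f.
Proof.
have Re0 b : 0 <= complex.Re `|b : R[i]| by rewrite -ler0c RRe_real.
suff e : opnorm (a *: f) = complex.Re `|a| * opnorm f.
  by rewrite /blin_norm e rmorphM; congr (_ * _); exact: RRe_real.
apply/eqP; rewrite eq_le opnormZ_le andTb.
have [->|a0] := eqVneq a 0; first by rewrite normr0 mul0r opnorm_ge0.
have := opnormZ_le a^-1 (a *: f).
rewrite scalerA mulVf// scale1r normfV => h.
rewrite (le_trans (ler_wpM2l (Re0 a) h))// mulrA.
suff -> : complex.Re `|a| * complex.Re `|a|^-1 = 1 :> R by rewrite mul1r.
have na0 : `|a| != 0 by rewrite normr_eq0.
apply: complexI; rewrite rmorphM -[RHS](divff na0).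
by congr (_ * _); apply: RRe_real; rewrite ?realV.
Qed.

Lemma blin_norm0_eq0 f : blin_norm f = 0 -> f = 0.
Proof.
move=> /complexI f0; apply: blin_ext => x; apply: rnorm_eq0.
by apply/eqP; rewrite eq_le rnorm_ge0 (le_trans (le_opnorm f x))// f0 mul0r.
Qed.

HB.instance Definition _ := Lmodule_isNormed.Build R[i] blin
  blin_normD blin_normZ blin_norm0_eq0.

End BoundedLinear.

Notation "''B(' H ')'" := (blin H H) (at level 8, format "''B(' H ')'") : type_scope.
Notation dual V := (blin V _^o).

Section Composition.
Variables (R : realType) (U V W : normedModType R[i]).
Variables (f : blin V W) (g : blin U V).

Lemma bounded_linear_comp : (f \o g) \in @bounded_linear R U W.
Proof.
apply/asboolP; split=> [a x y /=|]; first by rewrite !blin_linear.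
exists (opnorm f * opnorm g) => x /=; rewrite (le_trans (le_opnorm f _))//.
by rewrite -mulrA ler_wpM2l ?opnorm_ge0// le_opnorm.
Qed.

Definition blin_comp : blin U W := Blin bounded_linear_comp.

End Composition.

(* The unique operator g such that (f x | y) = (x | g y) for all x and y. *)
Definition adjoint (R : realType) (H K : hilbertType R) (f : blin H K) :
    blin K H :=
  xget 0 [set g : blin K H | forall x y, inner (f x) y = inner x (g y)].

Section Subspace.
Variables (R : realType) (V : normedModType R[i]) (S : submodClosed V).

Definition subspace_of := {x : V | x \in S}.
HB.instance Definition _ := SubChoice.on subspace_of.
HB.instance Definition _ := [SubChoice_isSubLmodule of subspace_of by <:].

Definition subspace_norm (x : subspace_of) : R[i] := `|val x|.

Lemma subspace_normD x y :
  subspace_norm (x + y) <= subspace_norm x + subspace_norm y.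
Proof. exact: ler_normD. Qed.

Lemma subspace_normZ a x : subspace_norm (a *: x) = `|a| * subspace_norm x.
Proof. exact: normrZ. Qed.

Lemma subspace_norm0_eq0 x : subspace_norm x = 0 -> x = 0.
Proof. by move=> /normr0_eq0 x0; apply: val_inj. Qed.

HB.instance Definition _ := Lmodule_isNormed.Build R[i] subspace_of
  subspace_normD subspace_normZ subspace_norm0_eq0.

End Subspace.

Section CstarAlgebra.
Variables (R : realType) (H : hilbertType R) (A : submodClosed 'B(H)).

Definition Cstar_subalgebra (S : set 'B(H)) :=
  [/\ S 0, forall a x y, S x -> S y -> S (a *: x + y),
      forall x y, S x -> S y -> S (blin_comp x y),
      forall x, S x -> S (adjoint x) & closed S].

(* As usual for the C*-algebra generated by a set of operators, this is the
   smallest one that contains it; it need not contain the identity of H. *)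
Definition Cstar_gen : set 'B(H) := smallest Cstar_subalgebra [set` A].

Definition Cstar_pred : {pred 'B(H)} := mem Cstar_gen.

Lemma Cstar_genP : Cstar_subalgebra Cstar_gen.
Proof.
split=> [S [[]]//|a x y Sx Sy S SP|x y Sx Sy S SP|x Sx S SP|].
- by have [[_ SZD _ _ _] _] := SP; apply: SZD; [apply: Sx|apply: Sy].
- by have [[_ _ SM _ _] _] := SP; apply: SM; [apply: Sx|apply: Sy].
- by have [[_ _ _ Sa _] _] := SP; apply: Sa; apply: Sx.
- by apply: closed_bigI => S [[]].
Qed.

Lemma Cstar_pred_submod_closed : submod_closed Cstar_pred.
Proof.
have [C0 CZD _ _ _] := Cstar_genP.
by split=> [|a x y /set_mem Cx /set_mem Cy]; apply/mem_set => //; exact: CZD.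
Qed.

HB.instance Definition _ := GRing.isSubmodClosed.Build R[i] 'B(H)
  Cstar_pred Cstar_pred_submod_closed.

Definition Cstar := subspace_of Cstar_pred.
HB.instance Definition _ := NormedModule.on Cstar.

Implicit Types x y : Cstar.

Lemma Cstar_mul_subproof x y : blin_comp (val x) (val y) \in Cstar_pred.
Proof.
have [_ _ CM _ _] := Cstar_genP; apply/mem_set.
exact: CM (set_mem (valP x)) (set_mem (valP y)).
Qed.

Lemma Cstar_adj_subproof x : adjoint (val x) \in Cstar_pred.
Proof.
have [_ _ _ Ca _] := Cstar_genP; apply/mem_set.
exact: Ca (set_mem (valP x)).
Qed.

Lemma Cstar_incl_subproof (x : subspace_of A) : val x \in Cstar_pred.
Proof. by apply/mem_set => S [_]; apply; exact: valP x. Qed.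

Definition cmul x y : Cstar := exist (fun z => z \in Cstar_pred) _ (Cstar_mul_subproof x y).
Definition cadj x : Cstar := exist (fun z => z \in Cstar_pred) _ (Cstar_adj_subproof x).
Definition to_Cstar (x : subspace_of A) : Cstar := exist (fun z => z \in Cstar_pred) _ (Cstar_incl_subproof x).

Definition state (p : dual Cstar) :=
  (forall x, 0 <= p (cmul (cadj x) x)) /\ `|p| = 1.

Definition star_representation (K : hilbertType R)
    (pi : {linear Cstar -> 'B(K)}) :=
  (forall x y, pi (cmul x y) = blin_comp (pi x) (pi y)) /\
  (forall x, pi (cadj x) = adjoint (pi x)).

Definition extension (T : {biscalar (subspace_of A)})
    (T' : {linear Cstar -> dual Cstar}) :=
  forall x y : subspace_of A, T' (to_Cstar y) (to_Cstar x) = T x y.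

Definition column_adjoint (K : hilbertType R) (a : Cstar -> K) (eta : K) :
    Cstar -> R[i] :=
  fun x => inner eta (a (cadj x)).

End CstarAlgebra.

Section MatrixNorms.
Variable R : realType.

Definition l2norm (V : normedModType R[i]) n (h : 'I_n -> V) : R :=
  Num.sqrt (\sum_i rnorm (h i) ^+ 2).

(* The norm of a matrix of operators, acting from H^n to H^m. *)
Definition opmx_norm (H : hilbertType R) m n (X : 'M['B(H)]_(m, n)) : R :=
  map_norm (@l2norm H n) (@l2norm H m) (fun h i => \sum_j X i j (h j)).

Definition submx_norm (H : hilbertType R) (S : submodClosed 'B(H)) n
    (X : 'M[subspace_of S]_n) : R :=
  opmx_norm (map_mx val X).

Definition column_norm (K : hilbertType R) n (xi : 'M[K]_n) : R :=
  map_norm (@l2norm R[i]^o n) (@l2norm K n)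
    (fun lambda i => \sum_j lambda j *: xi i j).

Section CompletelyBounded.
Variables (V W : Type).
Variables (nV : forall n, 'M[V]_n -> R) (nW : forall n, 'M[W]_n -> R).
Variable f : V -> W.

Definition completely_bounded :=
  exists M : R, forall n (X : 'M[V]_n), nW (map_mx f X) <= M * nV X.

(* As sup is 0 on unbounded sets, this is meaningful only when f is completely
   bounded. *)
Definition cbnorm : R :=
  sup [set r | exists n (X : 'M[V]_n), nV X <= 1 /\ r = nW (map_mx f X)].

End CompletelyBounded.
End MatrixNorms.

Section WHNorm.
Variables (R : realType) (H : hilbertType R) (A : submodClosed 'B(H)).
Local Notation form := {biscalar (subspace_of A)}.

(* The algebraic tensor product of A with itself is realized in the space of
   functionals on the bilinear forms on A, as the span of the elementary tensors
   B |-> B(x, y). The linear form on it induced by T, which maps the elementary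
   tensor of x and y to T(x, y), is then u |-> u T. *)
Definition elem_tensor (x y : subspace_of A) : form -> R[i] := fun B => B x y.

Definition tensor : set (form -> R[i]) :=
  [set u | exists n (x y : 'I_n -> subspace_of A),
    u = \sum_i elem_tensor (x i) (y i)].

Definition wh_norm (u : form -> R[i]) : R :=
  inf [set r | exists n (x y : 'I_n -> subspace_of A),
    u = \sum_i elem_tensor (x i) (y i) /\
    r = 2^-1 * opmx_norm (row_mx (\row_i val (x i))
                                 (\row_i adjoint (val (y i)))) ^+ 2].

Definition wh_dual_norm (T : form) : \bar R :=
  ereal_sup [set (complex.Re `|u T|)%:E | u in
    [set u | tensor u /\ wh_norm u <= 1]].

End WHNorm.

(* Main.v *)
Require Import Defs.
From HB Require Import structures.
From mathcomp Require Import all_boot all_order all_algebra.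
From mathcomp Require Import sesquilinear complex.
From mathcomp Require Import all_classical all_reals all_analysis.
From mathcomp Require Import ring lra.

Set Implicit Arguments.
Unset Strict Implicit.
Unset Printing Implicit Defensive.

Import Order.TTheory GRing.Theory Num.Theory.
Import numFieldNormedType.Exports.

Local Open Scope classical_set_scope.
Local Open Scope ring_scope.

(** The four conditions are tied together by one intermediate object, a unital
    positive functional [phi] on all of [B(H)] with
    [|T x y|^2 <= phi (x x^* ) phi (y^* y)] on [A].

    Whether the dual norm is at most one only depends on the finite families in
    [A]: it says that [|sum T(x_i, y_i)| <= c] as soon as the column of the
    [x_i^*] and the [y_i] has norm at most [(2 c)^(1/2)] ([wh_dualP]). Given such
    inequalities, let [p w] be the infimum of the [t] such that the operator
    [Re w + 1/2 sum (x_i x_i^* + y_i^* y_i)] is at most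
    [t + Re (sum T(x_i, y_i))] for some finite family. This [p] is sublinear, and
    a real linear functional below [p] ([hahn_banach]) is automatically positive
    and unital; evaluating it at [- 1/2 (x x^* + y^* y)] and optimizing over
    scalar multiples of [x] gives the domination of [T]
    ([dominating_functional]). Restricting [phi] to the generated C*-algebra and
    normalizing yields the state of the second condition. Conversely a state
    gives back the inequalities for finite families, by the arithmetic-geometric
    mean inequality.

    For the representation, the GNS construction is applied to [phi] and not to
    the state: as [B(H)] is unital, the cyclic vector is simply the class of the
    identity. The Hilbert space is the space of bounded conjugate-linear
    functionals on [B(H)] for the semi-inner product [phi (y^* x)]; it is
    complete, and [B(H)] is dense in it because a near minimizer of [|x|^2 - 2
    Re (f x)] nearly represents [f] ([near_riesz]). The form [T] is then
    contractive in [y xi] and [x^* xi], and applying the Riesz theorem in one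
    variable and then in the other extends it to a contraction [b] on the whole
    space ([gns_contraction]).

    From a representation, the map [a y = pi y xi] is a complete contraction
    into the column space and [a^* b a] extends [T]. What this needs is that
    [pi] is contractive on columns ([rep_column_contractive]): a self-adjoint
    [w] of norm less than one is [2 v - v^2] with [v] self-adjoint in the
    algebra, so [1 - pi w] is the square [(1 - pi v)^2]. Finally, a column
    factorization bounds [sum (b (a y_i) | a (x_i^* ))] by the norm of the
    single column made of the [x_i^*] and the [y_i], which is the inequality for
    finite families again. *)

Local Notation "f ∘ g" := (blin_comp f g) (at level 40, left associativity).

(** * Complex modulus and semi-inner products *)

Section Cabs.
Variable R : realType.
Implicit Types (z w : R[i]) (r : R).

(** The norm of [R[i]] takes its values in [R[i]]; this is the same modulus
    with values in [R]. *)
Definition cabs z : R := complex.Re `|z|.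

Lemma cabsE z : `|z| = (cabs z)%:C%C.
Proof. by rewrite /cabs RRe_real. Qed.

Lemma cabs_ge0 z : 0 <= cabs z.
Proof. by rewrite -ler0c -cabsE. Qed.

Lemma cabsM z w : cabs (z * w) = cabs z * cabs w.
Proof. by apply: complexI; rewrite rmorphM -!cabsE normrM. Qed.

Lemma cabsD z w : cabs (z + w) <= cabs z + cabs w.
Proof. by rewrite -lecR rmorphD /= -!cabsE ler_normD. Qed.

Lemma cabsB z w : cabs (z - w) = cabs (w - z).
Proof. by rewrite /cabs distrC. Qed.

Lemma cabs_real r : cabs r%:C%C = `|r|.
Proof. by rewrite /cabs normc_def /= expr0n addr0 sqrtr_sqr. Qed.

Lemma cabs0 : cabs 0 = 0. Proof. by rewrite /cabs normr0. Qed.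

Lemma cabs1 : cabs 1 = 1. Proof. by rewrite /cabs normr1. Qed.

Lemma cabs_eq0 z : cabs z = 0 -> z = 0.
Proof. by move=> z0; apply/normr0_eq0; rewrite cabsE z0. Qed.

Lemma conjC_conjc z : z^* = (z^*)%C.
Proof. by []. Qed.

Lemma cabsJ z : cabs z^* = cabs z.
Proof. by rewrite /cabs norm_conjC. Qed.

Lemma Re_conjC z : complex.Re z^* = complex.Re z.
Proof. by rewrite conjC_conjc; case: z. Qed.

Lemma conj_realc r : (r%:C%C : R[i])^* = r%:C%C.
Proof. by rewrite conjC_conjc conjc_real. Qed.

Lemma ReD z w : complex.Re (z + w) = complex.Re z + complex.Re w.
Proof. by case: z w => [a b] [c d]. Qed.

Lemma ReN z : complex.Re (- z) = - complex.Re z.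
Proof. by case: z. Qed.

Lemma Re_scale r z : complex.Re (r%:C%C * z) = r * complex.Re z.
Proof. by case: z => a b /=; rewrite mul0r subr0. Qed.

Lemma Re_le_cabs z : complex.Re z <= cabs z.
Proof.
rewrite (le_trans (ler_norm _))// -lecR -cabsE.
exact: normc_ge_Re.
Qed.

Lemma mul_conj_cabs z : z * z^* = (cabs z ^+ 2)%:C%C.
Proof. by rewrite -normCK cabsE rmorphXn. Qed.

Lemma ge0_Re z : 0 <= z -> z = (complex.Re z)%:C%C.
Proof. by move=> /ger0_real /RRe_real. Qed.

Lemma Re_ge0 z : 0 <= z -> 0 <= complex.Re z.
Proof. by move=> z0; rewrite -ler0c -ge0_Re. Qed.

Lemma Re_sum (I : Type) (s : seq I) (F : I -> R[i]) :
  complex.Re (\sum_(i <- s) F i) = \sum_(i <- s) complex.Re (F i).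
Proof. by elim/big_rec2: _ => // i x y _ <-; rewrite ReD. Qed.

End Cabs.

Lemma quad_discr (R : realType) (a b c : R) : 0 <= c ->
  (forall t : R, 0 <= a + t * b *+ 2 + t ^+ 2 * c) -> b ^+ 2 <= a * c.
Proof.
move=> c0 H; have [c00|c_neq0] := eqVneq c 0.
  have [->|b0] := eqVneq b 0; first by rewrite c00 expr0n mulr0.
  have := H (- (a + 1) / (b *+ 2)).
  rewrite c00 !mulr0 addr0 -mulrnAr divfK ?mulrn_eq0 ?negb_or//.
  by move=> h; exfalso; lra.
have := H (- b / c).
have -> : a + - b / c * b *+ 2 + (- b / c) ^+ 2 * c = (a * c - b ^+ 2) / c.
  by field.
by rewrite pmulr_lge0 ?invr_gt0 ?lt0r ?c_neq0// subr_ge0.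
Qed.

(** The form may be degenerate: the same theory serves for inner products, for
    their pullbacks along linear maps and for the forms given by positive
    functionals. *)
Record semi_inner (R : realType) (E : lmodType R[i]) := SemiInner {
  sip :> E -> E -> R[i] ;
  sip_scalar : forall y, scalar (sip^~ y) ;
  sipC : forall x y, sip x y = (sip y x)^* ;
  sip_ge0 : forall x, 0 <= sip x x
}.

Section SemiInnerTheory.
Variables (R : realType) (E : lmodType R[i]) (s : semi_inner E).
Implicit Types (x y z : E) (a : R[i]).

Definition snorm x : R := Num.sqrt (complex.Re (s x x)).

Lemma sipPl a x y z : s (a *: x + y) z = a * s x z + s y z.
Proof. exact: sip_scalar. Qed.

Lemma sip0l z : s 0 z = 0.
Proof. by have := sipPl (-1) 0 0 z; rewrite scaler0 addr0 mulN1r addNr. Qed.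

Lemma sipZl a x z : s (a *: x) z = a * s x z.
Proof. by rewrite -[a *: x]addr0 sipPl sip0l addr0. Qed.

Lemma sipDl x y z : s (x + y) z = s x z + s y z.
Proof. by rewrite -[x]scale1r sipPl mul1r scale1r. Qed.

Lemma sipNl x z : s (- x) z = - s x z.
Proof. by rewrite -scaleN1r sipZl mulN1r. Qed.

Lemma sipZr a x z : s z (a *: x) = a^* * s z x.
Proof. by rewrite sipC sipZl rmorphM /= -sipC. Qed.

Lemma sipDr x y z : s z (x + y) = s z x + s z y.
Proof. by rewrite sipC sipDl rmorphD /= -!sipC. Qed.

Lemma sipNr x z : s z (- x) = - s z x.
Proof. by rewrite -scaleN1r sipZr rmorphN1 mulN1r. Qed.

Lemma snorm_ge0 x : 0 <= snorm x. Proof. exact: sqrtr_ge0. Qed.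

Lemma snorm_sqr x : snorm x ^+ 2 = complex.Re (s x x).
Proof. by rewrite sqr_sqrtr// Re_ge0// sip_ge0. Qed.

Lemma sip_snorm x : s x x = (snorm x ^+ 2)%:C%C.
Proof. by rewrite snorm_sqr -ge0_Re ?sip_ge0. Qed.

Lemma snorm_sqrZ a x : snorm (a *: x) ^+ 2 = cabs a ^+ 2 * snorm x ^+ 2.
Proof.
by rewrite !snorm_sqr sipZl sipZr mulrA mul_conj_cabs Re_scale.
Qed.

Lemma snorm_sqrDt x y (t : R) : snorm (x + t%:C%C *: y) ^+ 2 =
  snorm x ^+ 2 + t * complex.Re (s y x) *+ 2 + t ^+ 2 * snorm y ^+ 2.
Proof.
rewrite !snorm_sqr sipDl !sipDr !sipZl !sipZr conj_realc !ReD.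
rewrite !Re_scale (sipC s x y) Re_conjC; ring.
Qed.

Lemma cauchy_schwarz x y : cabs (s x y) <= snorm x * snorm y.
Proof.
have key z : complex.Re (s z x) ^+ 2 <= snorm x ^+ 2 * snorm z ^+ 2.
  by apply: quad_discr => [|t]; rewrite ?sqr_ge0// -snorm_sqrDt sqr_ge0.
have [->|s0] := eqVneq (cabs (s x y)) 0.
  by rewrite mulr_ge0 ?snorm_ge0.
rewrite -(@ler_pXn2r _ 2) ?nnegrE ?mulr_ge0 ?snorm_ge0 ?cabs_ge0//.
(* the real estimate is turned into a complex one by rotating [y] *)
have := key (s x y *: y); rewrite sipZl (sipC s y x) mul_conj_cabs /=.
rewrite snorm_sqrZ (mulrCA (snorm x ^+ 2)) [leLHS]expr2 exprMn ler_pM2l//.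
by rewrite exprn_gt0// lt0r s0 cabs_ge0.
Qed.

(** Almost minimizing [|x|^2 - 2 Re (f x)] solves the Riesz representation
    problem up to a small error, even in an incomplete space: moving [x] along a
    direction [y] can decrease the functional by [d ^ 2] at most, and the
    discriminant bounds the defect of the representation in that direction. *)
Lemma near_riesz (G : set E) (f : E -> R[i]) (M d : R) :
    G 0 ->
    (forall a x y, G x -> G y -> G (a *: x + y)) ->
    (forall a x y, G x -> G y -> f (a *: x + y) = a * f x + f y) ->
    (forall x, G x -> cabs (f x) <= M * snorm x) -> 0 < d ->
  exists2 x, G x & forall y, G y -> cabs (s y x - f y) <= d * snorm y.
Proof.
move=> G0 GP fP fM d0.
pose J x := snorm x ^+ 2 - complex.Re (f x) *+ 2.
have Jlb x : G x -> - M ^+ 2 <= J x.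
  move=> Gx; rewrite /J; have := le_trans (Re_le_cabs _) (fM _ Gx).
  move: (complex.Re _) (snorm x) => r t rt.
  have : 0 <= (t - M) ^+ 2 by rewrite sqr_ge0.
  by nra.
have infJ : has_inf [set J x | x in G].
  split; first by exists (J 0); exists 0.
  by exists (- M ^+ 2) => _ [x Gx <-]; exact: Jlb.
have d20 : 0 < d ^+ 2 by rewrite exprn_gt0.
have [_ [x Gx <-] xd] := inf_adherent d20 infJ.
exists x => // y Gy; set z := s y x - f y.
have f0 : f 0 = 0.
  by have := fP (-1) 0 0 G0 G0; rewrite scaler0 addr0 mulN1r addNr.
have fZ a u : G u -> f (a *: u) = a * f u.
  by move=> Gu; have := fP a u 0 Gu G0; rewrite f0 !addr0.
have GZ a u : G u -> G (a *: u).
  by move=> Gu; have := GP a u 0 Gu G0; rewrite !addr0.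
have step (t : R) : 0 <= d ^+ 2 + t * cabs z ^+ 2 *+ 2
                      + t ^+ 2 * (cabs z ^+ 2 * snorm y ^+ 2).
  (* the factor [z^*] makes the linear term of the variation real *)
  pose u := z^* *: y; have Gu : G u by exact: GZ.
  have Gtu : G (t%:C%C *: u + x) by exact: GP.
  have := ge_inf infJ.2 (imageP J Gtu).
  move: xd; set I := inf _; rewrite /J [_ + x]addrC snorm_sqrDt [x + _]addrC.
  rewrite fP// ReD Re_scale fZ// sipZl snorm_sqrZ cabsJ => xd h.
  have e : complex.Re (z^* * s y x) - complex.Re (z^* * f y) = cabs z ^+ 2.
    by rewrite -ReN -ReD -mulrN -mulrDr -/z mulrC mul_conj_cabs.
  rewrite -{1}e; lra.
have := quad_discr (mulr_ge0 (sqr_ge0 _) (sqr_ge0 _)) step.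
have [->|z0] := eqVneq (cabs z) 0; first by move=> _; rewrite mulr_ge0 ?snorm_ge0// ltW.
rewrite (mulrCA (d ^+ 2)) [leLHS]expr2.
rewrite ler_pM2l ?exprn_gt0 ?lt0r ?z0 ?cabs_ge0//.
by rewrite -exprMn ler_pXn2r ?nnegrE ?mulr_ge0 ?snorm_ge0 ?cabs_ge0// ltW.
Qed.

End SemiInnerTheory.

(** * Limits of sequences *)

Lemma inv_succ_small (R : realType) (e : R) : 0 < e ->
  exists N, forall n, (N <= n)%N -> n.+1%:R^-1 <= e.
Proof.
move=> e0; exists (Num.truncn e^-1) => n Nn.
rewrite invf_ple ?posrE//; apply: ltW.
by rewrite (lt_le_trans (truncnS_gt _))// ler_nat ltnS.
Qed.

Section Sequences.
Variable R : realType.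

Section Normed.
Variable V : normedModType R[i].
Implicit Types (u v : nat -> V) (x l : V) (e : R).

Definition cauchy_seq u := forall e, 0 < e ->
  exists N, forall m n, (N <= m)%N -> (N <= n)%N -> rnorm (u m - u n) <= e.

Definition tends_to u l := forall e, 0 < e ->
  exists N, forall n, (N <= n)%N -> rnorm (u n - l) <= e.

Lemma rnormN x : rnorm (- x) = rnorm x.
Proof. by rewrite /rnorm normrN. Qed.

Lemma rnormB x y : rnorm (x - y) = rnorm (y - x).
Proof. by rewrite /rnorm distrC. Qed.

Lemma rnorm_dist x y z : rnorm (x - z) <= rnorm (x - y) + rnorm (y - z).
Proof. by rewrite -[x - z](subrKA y) rnormD. Qed.

Lemma rnormZ_cabs (a : R[i]) x : rnorm (a *: x) = cabs a * rnorm x.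
Proof. exact: rnormZ. Qed.

Lemma ball_rnorm x (e : R) y : ball x e%:C%C y <-> rnorm (x - y) < e.
Proof. by rewrite -ball_normE /ball_ /= rnormE ltcR. Qed.

Lemma tends_to_unique u l l' : tends_to u l -> tends_to u l' -> l = l'.
Proof.
move=> ul ul'; apply/eqP; rewrite -subr_eq0; apply/eqP/rnorm_eq0/eqP.
rewrite eq_le rnorm_ge0 andbT; apply/ler_addgt0Pr => e e0.
have e20 : 0 < e / 2 by rewrite divr_gt0.
have [N uN] := ul _ e20; have [N' uN'] := ul' _ e20.
rewrite add0r (le_trans (rnorm_dist _ (u (N + N')%N) _))// (splitr e).
by apply: lerD; [rewrite rnormB uN// leq_addr|rewrite uN'// leq_addl].
Qed.

Lemma tends_toP (a : R[i]) u v l m : tends_to u l -> tends_to v m ->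
  tends_to (fun n => a *: u n + v n) (a *: l + m).
Proof.
move=> ul vm e e0.
have e1 : 0 < e / 2 / (cabs a + 1).
  by rewrite !divr_gt0// ltr_wpDl// cabs_ge0.
have e2 : 0 < e / 2 by rewrite divr_gt0.
have [N uN] := ul _ e1; have [N' vN'] := vm _ e2.
exists (N + N')%N => n nN; rewrite opprD addrACA -scalerBr.
rewrite (le_trans (rnormD _ _))// rnormZ_cabs (splitr e) lerD//; last first.
  by rewrite vN'// (leq_trans _ nN)// leq_addl.
have := uN n (leq_trans (leq_addr _ _) nN).
rewrite ler_pdivlMr ?ltr_wpDl ?cabs_ge0// => h.
by rewrite mulrC (le_trans _ h)// ler_wpM2l ?rnorm_ge0// lerDl.
Qed.

Lemma tends_to_le u l x (M : R) (N : nat) : tends_to u l ->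
  (forall n, (N <= n)%N -> rnorm (u n - x) <= M) -> rnorm (l - x) <= M.
Proof.
move=> ul uM; apply/ler_addgt0Pr => e e0; have [N' uN'] := ul _ e0.
rewrite (le_trans (rnorm_dist _ (u (N + N')%N) _))// addrC.
by apply: lerD; [rewrite uM// leq_addr|rewrite rnormB uN'// leq_addl].
Qed.

Lemma closed_tends_to (S : set V) u l :
  closed S -> (forall n, S (u n)) -> tends_to u l -> S l.
Proof.
move=> clS Su ul; apply: clS => B /nbhs_ballP[e /= e0 eB].
have eE : e = (complex.Re e)%:C%C by rewrite -ge0_Re// ltW.
move: e0; rewrite eE ltcR => e0.
have e20 : 0 < complex.Re e / 2 by rewrite divr_gt0.
have [N uN] := ul _ e20; exists (u N); split; first exact: Su.
apply: eB; rewrite eE; apply/ball_rnorm; rewrite rnormB.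
by rewrite (le_lt_trans (uN _ _))// ltr_pdivrMr// ltr_pMr// ltr1n.
Qed.

Lemma seq_complete (F : set_system V) :
    (forall u, cauchy_seq u -> exists l, tends_to u l) ->
  ProperFilter F -> cauchy F -> cvg F.
Proof.
move=> Vc FF /cauchyP Fc.
have pick n : {x : V | F (ball x (n.+1%:R^-1)%:C%C)}.
  by apply: cid; apply: Fc; rewrite /= ltcR.
pose u n := sval (pick n).
have uF n : F (ball (u n) (n.+1%:R^-1)%:C%C) := svalP (pick n).
have [l ul] : exists l, tends_to u l.
  apply: Vc => e e0; have e20 : 0 < e / 2 by rewrite divr_gt0.
  have [N eN] := inv_succ_small e20; exists N => m n Nm Nn.
  have [y [/ball_rnorm my /ball_rnorm ny]] := filter_ex (filterI (uF m) (uF n)).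
  rewrite (le_trans (rnorm_dist _ y _))// (splitr e) lerD//.
    exact: le_trans (ltW my) (eN _ Nm).
  by rewrite rnormB; exact: le_trans (ltW ny) (eN _ Nn).
apply/cvg_ex; exists l => B /nbhs_ballP[e /= e0 eB].
have eE : e = (complex.Re e)%:C%C by rewrite -ge0_Re// ltW.
move: e0; rewrite eE ltcR => e0.
have e30 : 0 < complex.Re e / 3 by rewrite divr_gt0.
have [N eN] := inv_succ_small e30; have [N' uN'] := ul _ e30.
apply: filterS (uF (N + N')%N) => y /ball_rnorm uy; apply: eB.
rewrite eE; apply/ball_rnorm.
rewrite (le_lt_trans (rnorm_dist _ (u (N + N')%N) _))// rnormB.
have := uN' _ (leq_addl N N'); have := eN _ (leq_addr N' N).
by move: uy; set p := rnorm _; set q := rnorm _; set r := _^-1; lra.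
Qed.

End Normed.

Lemma cauchy_seq_lim (V : completeNormedModType R[i]) (u : nat -> V) :
  cauchy_seq u -> exists l, tends_to u l.
Proof.
move=> uc; suff /cauchy_cvgP/cvg_ex[/= l ul] : cauchy (u @ \oo).
  exists l => e e0.
  have : nbhs l (ball l e%:C%C) by apply: nbhsx_ballx; rewrite ltcR.
  move=> /ul[N _ uN]; exists N => n Nn; have /ball_rnorm := uN n Nn.
  by rewrite rnormB => /ltW.
apply/cauchyP => e /= e0.
have eE : e = (complex.Re e)%:C%C by rewrite -ge0_Re// ltW.
move: e0; rewrite eE ltcR => e0.
have e20 : 0 < complex.Re e / 2 by rewrite divr_gt0.
have [N uN] := uc _ e20; exists (u N); exists N => // n /= Nn.
apply/ball_rnorm; rewrite (le_lt_trans (uN _ _ _ _))//.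
by rewrite ltr_pdivrMr// ltr_pMr// ltr1n.
Qed.

Lemma cauchy_seq_complex (u : nat -> R[i]^o) :
  cauchy_seq u -> exists l, tends_to u l.
Proof.
have real_lim (v : nat -> R) : (forall e, 0 < e -> exists N, forall m n,
    (N <= m)%N -> (N <= n)%N -> `|v m - v n| <= e) ->
    exists l, forall e, 0 < e -> exists N, forall n, (N <= n)%N -> `|v n - l| <= e.
  move=> vc; suff /cauchy_cvgP/cvg_ex[/= l vl] : cauchy (v @ \oo).
    exists l => e e0; move/cvgrPdist_le : vl => /(_ e e0)[N _ vN].
    by exists N => n Nn; rewrite distrC; exact: vN.
  apply/cauchyP => e /= e0.
  have e20 : 0 < e / 2 by rewrite divr_gt0.
  have [N uN] := vc _ e20; exists (v N); exists N => // n /= Nn.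
  rewrite -ball_normE /ball_ /= (le_lt_trans (uN _ _ _ _))//.
  by rewrite ltr_pdivrMr// ltr_pMr// ltr1n.
have Re_le (z : R[i]) : `|complex.Re z| <= cabs z.
  by rewrite -lecR -cabsE normc_ge_Re.
have Im_le (z : R[i]) : `|complex.Im z| <= cabs z.
  by case: z => a b; rewrite /cabs normc_def /= -sqrtr_sqr ler_wsqrtr// lerDr sqr_ge0.
move=> uc.
have [a ua] : exists a, forall e, 0 < e -> exists N, forall n, (N <= n)%N ->
    `|complex.Re (u n) - a| <= e.
  apply: real_lim => e e0; have [N uN] := uc _ e0; exists N => m n Nm Nn.
  by rewrite -ReN -ReD (le_trans (Re_le _))// uN.
have [b ub] : exists b, forall e, 0 < e -> exists N, forall n, (N <= n)%N ->
    `|complex.Im (u n) - b| <= e.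
  apply: real_lim => e e0; have [N uN] := uc _ e0; exists N => m n Nm Nn.
  have -> : complex.Im (u m) - complex.Im (u n) = complex.Im (u m - u n).
    by case: (u m) (u n) => [? ?] [? ?].
  by rewrite (le_trans (Im_le _))// uN.
exists (a +i* b)%C => e e0; have e20 : 0 < e / 2 by rewrite divr_gt0.
have [N uN] := ua _ e20; have [N' uN'] := ub _ e20.
exists (N + N')%N => n nN.
have {}uN := uN _ (leq_trans (leq_addr _ _) nN).
have {}uN' := uN' _ (leq_trans (leq_addl _ _) nN).
move: uN uN'; rewrite /rnorm -/(cabs _); case: (u n) => p q /= pa qb.
have E : (p +i* q)%C - (a +i* b)%C = (p - a)%:C%C + 'i%C * (q - b)%:C%C :> R[i].
  by transitivity ((p - a) +i* (q - b))%C; [simpc|exact: complexE].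
rewrite -[leLHS]/(cabs ((p +i* q)%C - (a +i* b)%C)) E.
rewrite (le_trans (cabsD _ _))// cabsM !cabs_real (splitr e) lerD//.
by rewrite /cabs normc_def /= expr0n add0r expr1n sqrtr1 mul1r.
Qed.

End Sequences.

(** * Riesz representation and adjoints *)

Section Hilbert.
Variables (R : realType) (H : hilbertType R).
Implicit Types (x y z : H) (a : R[i]).

Lemma inner_scalar y : scalar ((inner : H -> H -> R[i])^~ y).
Proof. by move=> a x z; rewrite linearPl. Qed.

Lemma innerC x y : inner x y = (inner y x)^*.
Proof. by rewrite hermC expr0 mul1r. Qed.

Lemma inner_ge0 x : 0 <= inner x x.
Proof. by rewrite inner_norm exprn_ge0. Qed.

Definition hsip := SemiInner inner_scalar innerC inner_ge0.

Lemma snorm_hsip x : snorm hsip x = rnorm x.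
Proof.
rewrite /snorm /= inner_norm rnormE -rmorphXn /= sqrtr_sqr ger0_norm//.
exact: rnorm_ge0.
Qed.

Lemma inner_rnorm x : inner x x = (rnorm x ^+ 2)%:C%C.
Proof. by rewrite inner_norm rnormE rmorphXn. Qed.

Lemma innerPl a x y z : inner (a *: x + y) z = a * inner x z + inner y z.
Proof. exact: (sipPl hsip). Qed.

Lemma innerZl a x z : inner (a *: x) z = a * inner x z.
Proof. exact: (sipZl hsip). Qed.

Lemma innerDl x y z : inner (x + y) z = inner x z + inner y z.
Proof. exact: (sipDl hsip). Qed.

Lemma innerNl x z : inner (- x) z = - inner x z.
Proof. exact: (sipNl hsip). Qed.

Lemma inner0l z : inner 0 z = 0.
Proof. exact: (sip0l hsip). Qed.

Lemma innerZr a x z : inner z (a *: x) = a^* * inner z x.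
Proof. exact: (sipZr hsip). Qed.

Lemma innerDr x y z : inner z (x + y) = inner z x + inner z y.
Proof. exact: (sipDr hsip). Qed.

Lemma innerNr x z : inner z (- x) = - inner z x.
Proof. exact: (sipNr hsip). Qed.

Lemma innerPr a x y z : inner z (a *: x + y) = a^* * inner z x + inner z y.
Proof. by rewrite innerDr innerZr. Qed.

Lemma inner_suml (I : Type) (r : seq I) (F : I -> H) z :
  inner (\sum_(i <- r) F i) z = \sum_(i <- r) inner (F i) z.
Proof.
elim: r => [|i r IH]; first by rewrite !big_nil inner0l.
by rewrite !big_cons innerDl IH.
Qed.

Lemma inner_le x y : cabs (inner x y) <= rnorm x * rnorm y.
Proof. by rewrite -!snorm_hsip; exact: (cauchy_schwarz hsip). Qed.

Lemma inner_ext x y : (forall z, inner z x = inner z y) -> x = y.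
Proof.
move=> xy; apply/eqP; rewrite -subr_eq0; apply/eqP/rnorm_eq0/eqP.
rewrite -sqrf_eq0; apply/eqP/complexI; rewrite -inner_rnorm.
by rewrite innerDr innerNr xy subrr.
Qed.

End Hilbert.

Section Riesz.
Variables (R : realType) (K : hilbertType R) (E : lmodType R[i]).
Variables (alpha : E -> K) (G : set E).
Hypothesis alphaP : linear alpha.
Hypothesis G0 : G 0.
Hypothesis GP : forall a x y, G x -> G y -> G (a *: x + y).

Local Lemma alphaB x y : alpha (x - y) = alpha x - alpha y.
Proof. by rewrite addrC -scaleN1r alphaP scaleN1r addrC. Qed.

Definition pull_scalar y : scalar ((fun x y => inner (alpha x) (alpha y))^~ y).
Proof. by move=> a x z; rewrite alphaP innerPl. Qed.

Definition pull_sip : semi_inner E :=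
  SemiInner pull_scalar (fun x y => innerC (alpha x) (alpha y))
    (fun x => inner_ge0 (alpha x)).

Lemma snorm_pull x : snorm pull_sip x = rnorm (alpha x).
Proof. by rewrite -snorm_hsip. Qed.

Definition adherent (k : K) :=
  forall e : R, 0 < e -> exists2 x, G x & rnorm (k - alpha x) <= e.

Lemma adherentP a k l : adherent k -> adherent l -> adherent (a *: k + l).
Proof.
move=> ka la e e0.
have e1 : 0 < e / 2 / (cabs a + 1).
  by rewrite !divr_gt0// ltr_wpDl// cabs_ge0.
have e2 : 0 < e / 2 by rewrite divr_gt0.
have [x Gx xk] := ka _ e1; have [y Gy yl] := la _ e2.
exists (a *: x + y); first exact: GP.
rewrite alphaP opprD addrACA -scalerBr.
rewrite (le_trans (rnormD _ _))// rnormZ_cabs (splitr e) lerD//.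
move: xk; rewrite ler_pdivlMr ?ltr_wpDl ?cabs_ge0// => h.
by rewrite mulrC (le_trans _ h)// ler_wpM2l ?rnorm_ge0// lerDl.
Qed.

Lemma adherent_unique k l : adherent k -> adherent l ->
  (forall x, G x -> inner (alpha x) k = inner (alpha x) l) -> k = l.
Proof.
move=> ka la kl; apply/eqP; rewrite -subr_eq0; apply/eqP.
set d := k - l.
have dort x : G x -> inner (alpha x) d = 0.
  by move=> Gx; rewrite innerDr innerNr kl// subrr.
have : adherent d by rewrite /d -scaleN1r addrC; exact: adherentP.
move=> da; apply/rnorm_eq0/eqP; rewrite eq_le rnorm_ge0 andbT.
apply/ler_addgt0Pr => e e0; rewrite add0r; have [x Gx xd] := da _ e0.
have [->|d0] := eqVneq (rnorm d) 0; first exact: ltW.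
have dgt0 : 0 < rnorm d by rewrite lt0r d0 rnorm_ge0.
rewrite -(ler_pM2r dgt0) -expr2.
have -> : rnorm d ^+ 2 = cabs (inner (d - alpha x) d).
  rewrite innerDl innerNl dort// subr0 inner_rnorm cabs_real.
  by rewrite ger0_norm// exprn_ge0// rnorm_ge0.
by rewrite (le_trans (inner_le _ _))// ler_wpM2r// rnorm_ge0.
Qed.

(** The near representatives of [near_riesz] for errors tending to zero form a
    Cauchy sequence, since the difference of two of them is a test vector. *)
Lemma riesz_adherent (f : E -> R[i]) (M : R) : 0 <= M ->
    (forall a x y, G x -> G y -> f (a *: x + y) = a * f x + f y) ->
    (forall x, G x -> cabs (f x) <= M * rnorm (alpha x)) ->
  exists k, [/\ adherent k, rnorm k <= M &
    forall x, G x -> f x = inner (alpha x) k].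
Proof.
move=> M0 fP fM.
have pick n : {x | G x & forall y, G y ->
    cabs (inner (alpha y) (alpha x) - f y) <= n.+1%:R^-1 * rnorm (alpha y)}.
  apply: cid2; have n0 : 0 < n.+1%:R^-1 :> R by rewrite invr_gt0 ltr0n.
  have fM' x : G x -> cabs (f x) <= M * snorm pull_sip x.
    by move=> Gx; rewrite snorm_pull fM.
  have [x Gx xf] := near_riesz G0 GP fP fM' n0.
  by exists x => // y Gy; have := xf y Gy; rewrite snorm_pull.
pose u n := s2val (pick n).
have Gu n : G (u n) := s2valP (pick n).
have uf n y : G y -> cabs (inner (alpha y) (alpha (u n)) - f y)
    <= n.+1%:R^-1 * rnorm (alpha y) := s2valP' (pick n) y.
have sq_le (r t : R) : 0 <= r -> 0 <= t -> r ^+ 2 <= t * r -> r <= t.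
  move=> r0 t0; have [->//|rn0] := eqVneq r 0.
  by rewrite expr2 ler_pM2r// lt0r rn0.
have inv_ge0 n : 0 <= n.+1%:R^-1 :> R by rewrite invr_ge0.
have cu : cauchy_seq (alpha \o u).
  move=> e e0; have e20 : 0 < e / 2 by rewrite divr_gt0.
  have [N eN] := inv_succ_small e20; exists N => m n Nm Nn /=.
  rewrite (splitr e) (le_trans _ (lerD (eN _ Nm) (eN _ Nn)))//.
  rewrite -alphaB; set x := u m - u n.
  have Gx : G x by rewrite /x -scaleN1r addrC; exact: GP.
  apply: sq_le; rewrite ?rnorm_ge0 ?addr_ge0//.
  have -> : rnorm (alpha x) ^+ 2 = cabs (inner (alpha x) (alpha x)).
    by rewrite inner_rnorm cabs_real ger0_norm// exprn_ge0// rnorm_ge0.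
  have xE : inner (alpha x) (alpha x) =
      inner (alpha x) (alpha (u m)) - inner (alpha x) (alpha (u n)).
    by rewrite -innerNr -innerDr -alphaB.
  rewrite xE mulrDl.
  rewrite -[X in X - _](subrK (f x)) -addrA (le_trans (cabsD _ _))//.
  by rewrite lerD ?uf// cabsB uf.
have [k uk] := cauchy_seq_lim cu; exists k.
have kE x : G x -> f x = inner (alpha x) k.
  move=> Gx; apply/eqP; rewrite -subr_eq0; apply/eqP/cabs_eq0/eqP.
  rewrite eq_le cabs_ge0 andbT; apply/ler_addgt0Pr => e e0; rewrite add0r.
  have e1 : 0 < e / 2 / (rnorm (alpha x) + 1).
    by rewrite !divr_gt0// ltr_wpDl// rnorm_ge0.
  have [N eN] := inv_succ_small e1; have [N' ukN] := uk _ e1.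
  have {}eN := eN _ (leq_addr N' N); have {}ukN := ukN _ (leq_addl N N').
  set n := (N + N')%N in eN ukN.
  rewrite -[f x](subrK (inner (alpha x) (alpha (u n)))) -addrA.
  rewrite (le_trans (cabsD _ _))// (splitr e) lerD//.
    rewrite cabsB (le_trans (uf _ _ Gx))//.
    rewrite ler_pdivlMr ?ltr_wpDl ?rnorm_ge0// in eN.
    by rewrite (le_trans _ eN)// ler_wpM2l// lerDl.
  rewrite -innerNr -innerDr (le_trans (inner_le _ _))// mulrC.
  rewrite ler_pdivlMr ?ltr_wpDl ?rnorm_ge0// in ukN.
  by rewrite (le_trans _ ukN)// ler_wpM2l ?rnorm_ge0// lerDl.
have ka : adherent k.
  move=> e e0; have [N ukN] := uk _ e0.
  by exists (u N) => //; rewrite rnormB; exact: ukN.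
split=> //; apply/ler_addgt0Pr => e e0; have [N eN] := inv_succ_small e0.
rewrite -[k]subr0; apply: (tends_to_le uk (N := N)) => n Nn /=; rewrite subr0.
apply: sq_le; rewrite ?rnorm_ge0 ?addr_ge0 ?(ltW e0)//.
have -> : rnorm (alpha (u n)) ^+ 2 = cabs (inner (alpha (u n)) (alpha (u n))).
  by rewrite inner_rnorm cabs_real ger0_norm// exprn_ge0// rnorm_ge0.
rewrite -[inner _ _](subrK (f (u n))) (le_trans (cabsD _ _))// addrC mulrDl.
by rewrite lerD ?fM// (le_trans (uf _ _ (Gu n)))// ler_wpM2r ?rnorm_ge0 ?eN.
Qed.

(** A bounded functional on the range of [alpha] is represented by a vector of
    its closure. The uniqueness of that vector makes it depend linearly on the
    functional, so that a whole family is represented by a linear map. *)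
Lemma riesz_family (Z : lmodType R[i]) (F : Z -> E -> R[i]) (N : Z -> R) :
    (forall z, 0 <= N z) ->
    (forall z a x y, G x -> G y -> F z (a *: x + y) = a * F z x + F z y) ->
    (forall x a z w, G x -> F (a *: z + w) x = a^* * F z x + F w x) ->
    (forall z x, G x -> cabs (F z x) <= N z * rnorm (alpha x)) ->
  exists B : Z -> K, [/\ linear B, forall z, rnorm (B z) <= N z &
    forall z x, G x -> F z x = inner (alpha x) (B z)].
Proof.
move=> N0 FP FZ FN.
have pick z := cid (riesz_adherent (N0 z) (FP z) (FN z)).
exists (fun z => sval (pick z)); split.
- move=> a z w; have [kz _ Fz] := svalP (pick z).
  have [kw _ Fw] := svalP (pick w).
  have [k _ Fk] := svalP (pick (a *: z + w)).
  apply: adherent_unique => // [|x Gx]; first exact: adherentP.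
  by rewrite -Fk// FZ// innerPr -Fz// -Fw.
- by move=> z; have [_ ? _] := svalP (pick z).
- by move=> z; have [_ _ ?] := svalP (pick z).
Qed.

End Riesz.

Section BlinTheory.
Variables (R : realType) (V W : normedModType R[i]).
Implicit Types (f g : blin V W) (x y : V).

Lemma mk_blin (f : V -> W) (M : R) : linear f ->
  (forall x, rnorm (f x) <= M * rnorm x) -> exists g : blin V W, g =1 f.
Proof.
move=> lf fM; have fb : f \in @bounded_linear R V W by apply/asboolP; split=> //; exists M.
by exists (Blin fb).
Qed.

Lemma rnorm_blin_le f x : rnorm (f x) <= rnorm f * rnorm x.
Proof. exact: le_opnorm. Qed.

Lemma rnorm_blin_ge f M : 0 <= M -> (forall x, rnorm (f x) <= M * rnorm x) ->
  rnorm f <= M.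
Proof. exact: opnorm_le. Qed.

Lemma blinE_D f g x : (f + g) x = f x + g x. Proof. by []. Qed.

Lemma blinE_Z a f x : (a *: f) x = a *: f x. Proof. by []. Qed.

Lemma blinE_N f x : (- f) x = - f x.
Proof. by rewrite -scaleN1r blinE_Z scaleN1r. Qed.

Lemma blinE_0 x : (0 : blin V W) x = 0. Proof. by []. Qed.

Lemma blinE_sum (I : Type) (r : seq I) (F : I -> blin V W) x :
  (\sum_(i <- r) F i) x = \sum_(i <- r) F i x.
Proof. by elim: r => [|i r IH]; rewrite ?big_nil ?big_cons// blinE_D IH. Qed.

Lemma blinD f x y : f (x + y) = f x + f y.
Proof. by have := blin_linear f 1 x y; rewrite !scale1r. Qed.

Lemma blinN f x : f (- x) = - f x.
Proof. by rewrite -scaleN1r blinZ scaleN1r. Qed.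

Lemma blin_sum (I : Type) (r : seq I) (F : I -> V) f :
  f (\sum_(i <- r) F i) = \sum_(i <- r) f (F i).
Proof. by elim: r => [|i r IH]; rewrite ?big_nil ?big_cons ?blin0// blinD IH. Qed.

(** The pointwise limit of a Cauchy sequence of operators is attained uniformly
    on bounded sets. *)
Lemma blin_complete (u : nat -> blin V W) :
    (forall v : nat -> W, cauchy_seq v -> exists l, tends_to v l) ->
  cauchy_seq u -> exists l, tends_to u l.
Proof.
move=> Wc uc.
have upt x : cauchy_seq (fun n => u n x).
  move=> e e0; have e1 : 0 < e / (rnorm x + 1).
    by rewrite divr_gt0// ltr_wpDl// rnorm_ge0.
  have [N uN] := uc _ e1; exists N => m n Nm Nn.
  have := uN _ _ Nm Nn; rewrite ler_pdivlMr ?ltr_wpDl ?rnorm_ge0// => h.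
  rewrite -blinE_N -blinE_D (le_trans (rnorm_blin_le _ _))//.
  by rewrite (le_trans _ h)// ler_wpM2l ?rnorm_ge0// lerDl.
have [l ul] := choice (fun x => Wc _ (upt x)).
have ll : linear l.
  move=> a x y; apply: (tends_to_unique (ul _)).
  suff -> : (fun n => u n (a *: x + y)) = (fun n => a *: u n x + u n y).
    exact: tends_toP.
  by apply/funext => n; rewrite blin_linear.
have unif e : 0 < e -> exists N, forall n, (N <= n)%N ->
    forall x, rnorm (u n x - l x) <= e * rnorm x.
  move=> e0; have [N uN] := uc _ e0; exists N => n Nn x.
  rewrite rnormB; apply: (tends_to_le (ul x) (N := N)) => m Nm.
  rewrite -blinE_N -blinE_D (le_trans (rnorm_blin_le _ _))//.
  by rewrite ler_wpM2r ?rnorm_ge0// uN.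
have [N uN] := unif _ ltr01.
have lb x : rnorm (l x) <= (rnorm (u N) + 1) * rnorm x.
  rewrite -[l x](subrK (u N x)) addrC (le_trans (rnormD _ _))// mulrDl.
  by apply: lerD; [exact: rnorm_blin_le|rewrite rnormB uN].
have [g gl] := mk_blin ll lb; exists g => e e0.
have [N' uN'] := unif _ e0; exists N' => n Nn.
apply: rnorm_blin_ge => [|x]; first exact: ltW.
by rewrite blinE_D blinE_N gl uN'.
Qed.

End BlinTheory.

Lemma rnorm_comp (R : realType) (U V W : normedModType R[i])
    (f : blin V W) (g : blin U V) : rnorm (f ∘ g) <= rnorm f * rnorm g.
Proof.
apply: rnorm_blin_ge => [|x]; first by rewrite mulr_ge0 ?rnorm_ge0.
rewrite (le_trans (rnorm_blin_le f (g x)))// -mulrA.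
by rewrite ler_wpM2l ?rnorm_ge0 ?rnorm_blin_le.
Qed.

Section Adjoint.
Variable R : realType.

Lemma adjointP (H K : hilbertType R) (f : blin H K) x y :
  inner (f x) y = inner x (adjoint f y).
Proof.
have id_lin : linear (fun x : H => x) by [].
have [||||B [lB BN BE]] := @riesz_family R H H id setT id_lin I (fun _ _ _ _ _ => I) K
    (fun y x => inner (f x) y) (fun y => rnorm f * rnorm y).
- by move=> z; rewrite mulr_ge0 ?rnorm_ge0.
- by move=> z a u v _ _; rewrite blin_linear innerPl.
- by move=> u a z w _; rewrite innerPr.
- move=> z u _; rewrite (le_trans (inner_le _ _))// mulrAC.
  by rewrite ler_wpM2r ?rnorm_ge0 ?rnorm_blin_le.
have [g gB] := mk_blin lB BN.
have ex : exists g : blin K H, forall x y, inner (f x) y = inner x (g y).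
  by exists g => u v; rewrite gB BE.
exact: (xgetPex 0 ex).
Qed.

Lemma adjoint_unique (H K : hilbertType R) (f : blin H K) (g : blin K H) :
  (forall x y, inner (f x) y = inner x (g y)) -> adjoint f = g.
Proof.
by move=> fg; apply: blin_ext => y; apply: inner_ext => x; rewrite -adjointP fg.
Qed.

Lemma adjointPr (H K : hilbertType R) (f : blin H K) x y :
  inner (adjoint f x) y = inner x (f y).
Proof. by rewrite innerC -adjointP -innerC. Qed.

Lemma adjointK (H K : hilbertType R) (f : blin H K) : adjoint (adjoint f) = f.
Proof. by apply: adjoint_unique => x y; rewrite adjointPr. Qed.

Lemma adjoint_comp (H K L : hilbertType R) (f : blin K L) (g : blin H K) :
  adjoint (f ∘ g) = adjoint g ∘ adjoint f.
Proof. by apply: adjoint_unique => x y; rewrite /= !adjointP. Qed.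

Lemma adjoint_lin (H K : hilbertType R) a (f g : blin H K) :
  adjoint (a *: f + g) = a^* *: adjoint f + adjoint g.
Proof.
apply: adjoint_unique => x y.
rewrite !blinE_D !blinE_Z innerDl innerDr innerZl innerZr conjCK.
by rewrite !adjointP.
Qed.

Lemma adjoint0 (H K : hilbertType R) : adjoint (0 : blin H K) = 0.
Proof.
by apply: adjoint_unique => x y; rewrite !blinE_0 inner0l innerC inner0l rmorph0.
Qed.

Lemma adjointZ (H K : hilbertType R) a (f : blin H K) :
  adjoint (a *: f) = a^* *: adjoint f.
Proof. by have := adjoint_lin a f 0; rewrite adjoint0 !addr0. Qed.

Lemma adjointD (H K : hilbertType R) (f g : blin H K) :
  adjoint (f + g) = adjoint f + adjoint g.
Proof. by have := adjoint_lin 1 f g; rewrite rmorph1 !scale1r. Qed.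

Lemma adjointB (H K : hilbertType R) (f g : blin H K) :
  adjoint (f - g) = adjoint f - adjoint g.
Proof. by rewrite adjointD -scaleN1r adjointZ rmorphN1 scaleN1r. Qed.

Lemma rnorm_adjoint_le (H K : hilbertType R) (f : blin H K) :
  rnorm (adjoint f) <= rnorm f.
Proof.
apply: rnorm_blin_ge => [|y]; first exact: rnorm_ge0.
set x := adjoint f y; have [->|x0] := eqVneq (rnorm x) 0.
  by rewrite mulr_ge0 ?rnorm_ge0.
have xgt0 : 0 < rnorm x by rewrite lt0r x0 rnorm_ge0.
rewrite -(ler_pM2r xgt0) -expr2.
have -> : rnorm x ^+ 2 = cabs (inner (f x) y).
  by rewrite adjointP inner_rnorm cabs_real ger0_norm// exprn_ge0 ?rnorm_ge0.
rewrite (le_trans (inner_le _ _))// mulrAC ler_wpM2r ?rnorm_ge0//.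
exact: rnorm_blin_le.
Qed.

End Adjoint.

(** * Contractivity of star-representations *)

Section FiniteCS.
Variables (R : realType) (I : Type) (r : seq I).

Lemma sum_cauchy_schwarz (a b : I -> R) :
  (\sum_(i <- r) a i * b i) ^+ 2 <=
  (\sum_(i <- r) a i ^+ 2) * (\sum_(i <- r) b i ^+ 2).
Proof.
apply: quad_discr => [|t]; first by apply: sumr_ge0 => i _; exact: sqr_ge0.
have -> : \sum_(i <- r) a i ^+ 2 + t * (\sum_(i <- r) a i * b i) *+ 2 +
    t ^+ 2 * (\sum_(i <- r) b i ^+ 2) = \sum_(i <- r) (a i + t * b i) ^+ 2.
  rewrite !mulr_sumr -sumrMnl -!big_split /=; apply: eq_bigr => i _; ring.
by apply: sumr_ge0 => i _; exact: sqr_ge0.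
Qed.

Lemma column_inner_le (H K : hilbertType R) (c : I -> blin H K) (D : R) h k :
    0 <= D -> (forall h, \sum_(i <- r) rnorm (c i h) ^+ 2 <= D * rnorm h ^+ 2) ->
  cabs (\sum_(i <- r) inner (c i h) (c i k)) <= D * (rnorm h * rnorm k).
Proof.
move=> D0 cD.
have /le_trans -> // : cabs (\sum_(i <- r) inner (c i h) (c i k)) <=
    \sum_(i <- r) rnorm (c i h) * rnorm (c i k).
  elim/big_rec2 : _ => [|i x y _ xy]; first by rewrite cabs0.
  by rewrite (le_trans (cabsD _ _))// lerD ?inner_le.
have p0 : 0 <= D * (rnorm h * rnorm k).
  by rewrite mulr_ge0 ?mulr_ge0 ?rnorm_ge0.
rewrite -(@ler_pXn2r _ 2) ?nnegrE//; last first.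
  by apply: sumr_ge0 => i _; rewrite mulr_ge0 ?rnorm_ge0.
rewrite (le_trans (sum_cauchy_schwarz _ _))//.
have -> : (D * (rnorm h * rnorm k)) ^+ 2 =
  (D * rnorm h ^+ 2) * (D * rnorm k ^+ 2) by ring.
by apply: ler_pM => //; apply: sumr_ge0 => i _; exact: sqr_ge0.
Qed.

(** The Gram operator is paired with its own image, and the Cauchy-Schwarz
    inequality applied over the family. *)
Lemma rnorm_gram_le (H K : hilbertType R) (c : I -> blin H K) (D : R) :
    0 <= D -> (forall h, \sum_(i <- r) rnorm (c i h) ^+ 2 <= D * rnorm h ^+ 2) ->
  rnorm (\sum_(i <- r) adjoint (c i) ∘ c i) <= D.
Proof.
move=> D0 cD; apply: rnorm_blin_ge => // h.
set w := \sum_(i <- r) _; set k := w h.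
have [->|k0] := eqVneq (rnorm k) 0; first by rewrite mulr_ge0 ?rnorm_ge0.
have kgt0 : 0 < rnorm k by rewrite lt0r k0 rnorm_ge0.
rewrite -(ler_pM2r kgt0) -expr2.
have -> : rnorm k ^+ 2 = cabs (inner k k).
  by rewrite inner_rnorm cabs_real ger0_norm// exprn_ge0 ?rnorm_ge0.
rewrite {1}/k /w blinE_sum inner_suml.
under eq_bigr do rewrite [X in inner X _]/= adjointPr.
by rewrite -mulrA column_inner_le.
Qed.

End FiniteCS.

Section QuasiSqrt.
Variables (R : realType) (H : hilbertType R).
Implicit Types (v w : 'B(H)).

Lemma comp_distr (U V W : normedModType R[i]) (f g : blin V W) (h k : blin U V) :
  f ∘ h - g ∘ k = f ∘ (h - k) + (f - g) ∘ k.
Proof.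
apply: blin_ext => x.
transitivity (f (h x) - g (k x)); first by rewrite blinE_D blinE_N.
transitivity (f ((h - k) x) + (f - g) (k x)); last by [].
by rewrite !blinE_D !blinE_N blinD blinN addrA subrK.
Qed.

Lemma rnorm_closed_ball (V : normedModType R[i]) (u : nat -> V) l (M : R) :
  tends_to u l -> (forall n, rnorm (u n) <= M) -> rnorm l <= M.
Proof.
move=> ul uM; rewrite -[l]subr0; apply: (tends_to_le ul (N := 0)) => n _.
by rewrite subr0.
Qed.

(** [v = 1 - (1 - w)^(1/2)], which lies in the algebra although the identity
    need not: it is the fixed point of [v |-> (w + v^2) / 2], a contraction of
    the ball of radius [|w| < 1]. *)
Lemma quasi_sqrt (S : set 'B(H)) w : Cstar_subalgebra S -> S w ->
    adjoint w = w -> rnorm w < 1 ->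
  exists v, [/\ S v, adjoint v = v & w = v + v - v ∘ v].
Proof.
move=> [S0 SP SM _ Scl] Sw wsa w1; set rho := rnorm w in w1.
have rho0 : 0 <= rho by exact: rnorm_ge0.
pose f v : 'B(H) := (2^-1%:C%C : R[i]) *: (w + v ∘ v).
(* all iterates are self-adjoint, in [S] and in the ball of radius [rho] *)
pose u n := iter n f 0.
have cabs2 : cabs (2^-1%:C%C : R[i]) = 2^-1 :> R by rewrite cabs_real ger0_norm.
have fS v : S v -> S (f v).
  move=> Sv; rewrite /f -[_ *: _]addr0; apply: (SP) => //.
  by rewrite -[w]scale1r; exact: SP (SM _ _ Sv Sv).
have fsa v : adjoint v = v -> adjoint (f v) = f v.
  by move=> vsa; rewrite /f adjointZ conj_realc adjointD adjoint_comp vsa wsa.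
have fle v : rnorm v <= rho -> rnorm (f v) <= rho.
  move=> vrho; rewrite /f rnormZ_cabs cabs2.
  rewrite (le_trans (ler_wpM2l _ (rnormD _ _)))//.
  have : rnorm (v ∘ v) <= rho.
    rewrite (le_trans (rnorm_comp _ _))// -[leRHS]mulr1.
    by rewrite ler_pM ?rnorm_ge0// (le_trans vrho)// ltW.
  by rewrite -/rho => ?; lra.
have fcontr v v' : rnorm v <= rho -> rnorm v' <= rho ->
    rnorm (f v - f v') <= rho * rnorm (v - v').
  move=> vr vr'; rewrite /f -scalerBr opprD addrACA subrr add0r rnormZ_cabs cabs2.
  rewrite comp_distr (le_trans (ler_wpM2l _ (rnormD _ _)))//.
  have h1 : rnorm (v ∘ (v - v')) <= rho * rnorm (v - v').
    by rewrite (le_trans (rnorm_comp _ _))// ler_wpM2r ?rnorm_ge0.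
  have h2 : rnorm ((v - v') ∘ v') <= rho * rnorm (v - v').
    by rewrite (le_trans (rnorm_comp _ _))// mulrC ler_wpM2r ?rnorm_ge0.
  lra.
have uS n : S (u n) by elim: n => //= n; exact: fS.
have usa n : adjoint (u n) = u n.
  by elim: n => [|n] /=; [exact: adjoint0|exact: fsa].
have ule n : rnorm (u n) <= rho.
  by elim: n => [|n] /=; [rewrite rnorm0|exact: fle].
have uit n k : rnorm (u (n + k)%N - u n) <= rho ^+ n.
  elim: n => [|n IH] /=.
    by rewrite subr0 add0n expr0 (le_trans (ule _))// ltW.
  by rewrite exprS (le_trans (fcontr _ _ _ _))// ler_wpM2l.
have rho_small (e : R) : 0 < e -> exists N, rho ^+ N <= e.
  move=> e0; have rho1 : `|rho| < 1 by rewrite ger0_norm.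
  have /cvgrPdist_le/(_ e e0)[N _ h] := cvg_expr rho1.
  exists N; have := h N (leqnn N); rewrite /= sub0r normrN ger0_norm//.
  exact: exprn_ge0.
have cu : cauchy_seq u.
  move=> e e0; have e20 : 0 < e / 2 by rewrite divr_gt0.
  have [N eN] := rho_small _ e20; exists N => m n Nm Nn.
  rewrite (le_trans (rnorm_dist _ (u N) _))// (splitr e) lerD//.
    by rewrite -(subnKC Nm) (le_trans (uit _ _)).
  by rewrite rnormB -(subnKC Nn) (le_trans (uit _ _)).
have [v uv] := blin_complete (@cauchy_seq_lim R H) cu.
have Sv : S v by exact: closed_tends_to Scl uS uv.
have vle : rnorm v <= rho by exact: rnorm_closed_ball uv ule.
have fix_v : v = f v.
  apply: (@tends_to_unique _ _ (fun n => u n.+1)) => e e0.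
    by have [N uN] := uv _ e0; exists N => n Nn; apply: uN; exact: leqW.
  have [N uN] := uv _ e0; exists N => n Nn /=.
  rewrite (le_trans (fcontr _ _ _ _))// -[leRHS]mul1r.
  by rewrite ler_pM ?rnorm_ge0 ?uN// ltW.
exists v; split=> //.
  apply/eqP; rewrite -subr_eq0; apply/eqP/rnorm_eq0/eqP.
  rewrite eq_le rnorm_ge0 andbT; apply/ler_addgt0Pr => e e0; rewrite add0r.
  have e20 : 0 < e / 2 by rewrite divr_gt0.
  have [N uN] := uv _ e20; have {}uN := uN _ (leqnn N).
  rewrite (le_trans (rnorm_dist _ (u N) _))// (splitr e) lerD//.
  by rewrite -(usa N) -adjointB (le_trans (rnorm_adjoint_le _))// rnormB.
have -> : v + v = (2%:R : R[i]) *: v by rewrite scaler_nat mulr2n.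
rewrite {1}fix_v /f scalerA.
have -> : 2 * (2^-1%:C%C) = 1 :> R[i].
  by rewrite fmorphV /= rmorphMn /= mulfV// pnatr_eq0.
by rewrite scale1r addrK.
Qed.

End QuasiSqrt.

Section Contractive.
Variables (R : realType) (H K : hilbertType R) (A : submodClosed 'B(H)).
Variables (pi : {linear Cstar A -> 'B(K)}).
Hypothesis piP : star_representation pi.

Lemma val_sumC (I : Type) (r : seq I) (F : I -> Cstar A) :
  val (\sum_(i <- r) F i) = \sum_(i <- r) val (F i).
Proof. by elim: r => [|i r IH]; rewrite ?big_nil// !big_cons -IH. Qed.

(** Complete contractivity on columns: for [w = 1/t sum z_i^* z_i] of norm less
    than one, [w = 2 v - v^2] with [v] self-adjoint in the algebra, so
    [1 - pi w = (1 - pi v)^2] is a positive operator. *)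
Lemma rep_column_contractive (I : Type) (r : seq I) (z : I -> Cstar A)
    (D : R) (xi : K) : 0 <= D ->
    (forall h, \sum_(i <- r) rnorm (val (z i) h) ^+ 2 <= D * rnorm h ^+ 2) ->
  \sum_(i <- r) rnorm (pi (z i) xi) ^+ 2 <= D * rnorm xi ^+ 2.
Proof.
move=> D0 zD.
suff main (t : R) : D < t ->
    \sum_(i <- r) rnorm (pi (z i) xi) ^+ 2 <= t * rnorm xi ^+ 2.
  apply/ler_addgt0Pr => e e0.
  have e1 : 0 < e / (rnorm xi ^+ 2 + 1).
    by rewrite divr_gt0// ltr_wpDl// exprn_ge0// rnorm_ge0.
  have := main (D + e / (rnorm xi ^+ 2 + 1)); rewrite ltrDl e1 => /(_ isT).
  move=> /le_trans; apply; rewrite mulrDl lerD2l -mulrA ler_piMr ?(ltW e0)//.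
  rewrite mulrC ler_pdivrMr ?mul1r ?lerDl//.
  by rewrite ltr_wpDl// exprn_ge0// rnorm_ge0.
move=> Dt; have t0 : 0 < t by exact: le_lt_trans D0 Dt.
pose w : Cstar A := (t^-1%:C%C : R[i]) *: \sum_(i <- r) cmul (cadj (z i)) (z i).
have wE : val w = (t^-1%:C%C : R[i]) *: \sum_(i <- r) adjoint (val (z i)) ∘ val (z i).
  rewrite -[RHS]/(_ *: \sum_(i <- r) val (cmul (cadj (z i)) (z i))).
  by rewrite -val_sumC.
have wsa : adjoint (val w) = val w.
  apply: adjoint_unique => h k; rewrite wE !blinE_Z innerZl innerZr conj_realc.
  rewrite !blinE_sum inner_suml (innerC h) inner_suml rmorph_sum.
  congr (_ * _); apply: eq_bigr => i _.
  by rewrite /= -innerC adjointPr -adjointP.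
have w1 : rnorm (val w) < 1.
  rewrite wE rnormZ_cabs cabs_real ger0_norm ?invr_ge0 ?(ltW t0)//.
  rewrite ltr_pdivrMl// mulr1 (le_lt_trans _ Dt)//.
  exact: (rnorm_gram_le (c := fun i => val (z i))).
have [v0 [Sv vsa wv]] := quasi_sqrt (Cstar_genP A) (set_mem (valP w)) wsa w1.
pose v : Cstar A := exist (fun z => z \in Cstar_pred A) v0 (mem_set Sv).
have wv' : w = v + v - cmul v v by apply: val_inj; exact: wv.
have vv : cadj v = v by apply: val_inj; exact: vsa.
have pv : adjoint (pi v) = pi v by rewrite -piP.2 vv.
have Ew : inner (pi w xi) xi = (t^-1 * \sum_(i <- r) rnorm (pi (z i) xi) ^+ 2)%:C%C.
  have -> : pi w = (t^-1%:C%C : R[i]) *: \sum_(i <- r) pi (cmul (cadj (z i)) (z i)).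
    by rewrite /w linearZ linear_sum.
  rewrite blinE_Z innerZl rmorphM; congr (_ * _).
  rewrite blinE_sum inner_suml rmorph_sum; apply: eq_bigr => i _.
  by rewrite piP.1 piP.2 /= adjointPr inner_rnorm.
have : t^-1 * \sum_(i <- r) rnorm (pi (z i) xi) ^+ 2 <= rnorm xi ^+ 2.
  have -> : t^-1 * \sum_(i <- r) rnorm (pi (z i) xi) ^+ 2 =
      complex.Re (inner (pi w xi) xi) by rewrite Ew.
  have : 0 <= rnorm (xi - pi v xi) ^+ 2 by rewrite exprn_ge0 ?rnorm_ge0.
  have -> : rnorm (xi - pi v xi) ^+ 2 =
      complex.Re (inner (xi - pi v xi) (xi - pi v xi)) by rewrite inner_rnorm.
  have -> : pi w = pi v + pi v - pi (cmul v v) by rewrite wv' linearB linearD.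
  rewrite piP.1 blinE_D blinE_N blinE_D.
  rewrite [(pi v ∘ pi v) xi]/(pi v (pi v xi)).
  have e1 : inner (pi v xi) xi = inner xi (pi v xi) by rewrite adjointP pv.
  have e2 : inner (pi v (pi v xi)) xi = inner (pi v xi) (pi v xi).
    by rewrite adjointP pv.
  rewrite !(innerDl, innerDr, innerNl, innerNr) e1 e2 opprK !ReD !ReN.
  rewrite -[rnorm xi ^+ 2]/(complex.Re (rnorm xi ^+ 2)%:C%C) -inner_rnorm; lra.
by rewrite mulrC ler_pdivrMr// mulrC.
Qed.

Lemma rep_contractive (z : Cstar A) xi : rnorm (pi z xi) <= rnorm z * rnorm xi.
Proof.
have := @rep_column_contractive _ [:: tt] (fun=> z) (rnorm z ^+ 2) xi (sqr_ge0 _).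
rewrite big_cons big_nil addr0 -exprMn => h.
rewrite -(@ler_pXn2r _ 2) ?nnegrE ?mulr_ge0 ?rnorm_ge0// h// => k.
rewrite big_cons big_nil addr0 -exprMn ler_pXn2r ?nnegrE ?mulr_ge0 ?rnorm_ge0//.
exact: rnorm_blin_le.
Qed.

End Contractive.

(** * The Hilbert space of a semi-inner product *)

Section Completion.
Variables (R : realType) (E : lmodType R[i]) (s : semi_inner E).

Definition bounded_conj : {pred E -> R[i]^o} := fun f =>
  `[< (forall a x y, f (a *: x + y) = a^* * f x + f y) /\
      exists2 M : R, 0 <= M & forall x, cabs (f x) <= M * snorm s x >].

Lemma bounded_conj_submod_closed : submod_closed bounded_conj.
Proof.
split=> [|a f g /asboolP[fP [M M0 fM]] /asboolP[gP [N N0 gN]]].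
  apply/asboolP; split=> [a x y|]; first by rewrite /GRing.zero /= mulr0 addr0.
  by exists 0 => // x; rewrite /GRing.zero /= cabs0 mul0r.
apply/asboolP; split=> [b x y|].
  rewrite !fctE fP gP /GRing.scale /=; ring.
exists (cabs a * M + N) => [|x]; first by rewrite addr_ge0 ?mulr_ge0 ?cabs_ge0.
rewrite !fctE (le_trans (cabsD _ _))// mulrDl lerD//.
by rewrite cabsM -mulrA ler_wpM2l ?cabs_ge0.
Qed.

HB.instance Definition _ := GRing.isSubmodClosed.Build R[i] (E -> R[i]^o)
  bounded_conj bounded_conj_submod_closed.

(** The bounded conjugate-linear functionals on [E]. As in any Hilbert space,
    every vector is determined by its inner products with a dense subspace; this
    realizes the completion of [E] modulo its null space without quotients or
    classes of Cauchy sequences. *)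
Record completion := Completion {
  completion_fun :> E -> R[i]^o ;
  completionP : completion_fun \in bounded_conj
}.
HB.instance Definition _ := [isSub of completion for completion_fun].
HB.instance Definition _ := [Choice of completion by <:].
HB.instance Definition _ := [SubChoice_isSubLmodule of completion by <:].

Implicit Types f g h : completion.

Lemma completion_ext f g : f =1 g -> f = g.
Proof. by move=> fg; apply/val_inj/funext. Qed.

Lemma completion_lin f a x y : f (a *: x + y) = a^* * f x + f y.
Proof. by have /asboolP[] := valP f. Qed.

Lemma completionB f x y : f (x - y) = f x - f y.
Proof.
by rewrite addrC -scaleN1r completion_lin rmorphN1 mulN1r addrC.
Qed.

Lemma completionE_D f g x : (f + g) x = f x + g x. Proof. by []. Qed.
Lemma completionE_Z a f x : (a *: f) x = a * f x. Proof. by []. Qed.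

Lemma completionE_N f x : (- f) x = - f x.
Proof. by rewrite -scaleN1r completionE_Z mulN1r. Qed.
Lemma completionE_B f g x : (f - g) x = f x - g x.
Proof. by rewrite completionE_D completionE_N. Qed.

Definition cnorm f : R :=
  inf [set M | 0 <= M /\ forall x, cabs (f x) <= M * snorm s x].

Lemma cnorm_has_inf f :
  has_inf [set M | 0 <= M /\ forall x, cabs (f x) <= M * snorm s x].
Proof.
have /asboolP[_ [M M0 fM]] := valP f.
by split; [exists M|exists 0 => N []].
Qed.

Lemma cnorm_ge0 f : 0 <= cnorm f.
Proof.
by apply: lb_le_inf => [|M []//]; have [] := cnorm_has_inf f.
Qed.

Lemma le_cnorm f x : cabs (f x) <= cnorm f * snorm s x.
Proof.
have [p0|p0] := eqVneq (snorm s x) 0.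
  have /asboolP[_ [M M0 fM]] := valP f.
  by have := fM x; rewrite p0 !mulr0.
have pgt0 : 0 < snorm s x by rewrite lt0r p0 snorm_ge0.
rewrite -ler_pdivrMr//; apply: lb_le_inf => [|M [M0 fM]].
  by have [] := cnorm_has_inf f.
by rewrite ler_pdivrMr.
Qed.

Lemma cnorm_le f M : 0 <= M -> (forall x, cabs (f x) <= M * snorm s x) ->
  cnorm f <= M.
Proof. by move=> M0 fM; apply: ge_inf => //; have [] := cnorm_has_inf f. Qed.

Definition completion_norm f : R[i] := (cnorm f)%:C%C.

Lemma completion_normD f g :
  completion_norm (f + g) <= completion_norm f + completion_norm g.
Proof.
rewrite -rmorphD lecR; apply: cnorm_le => [|x].
  by rewrite addr_ge0 ?cnorm_ge0.
by rewrite (le_trans (cabsD _ _))// mulrDl lerD// le_cnorm.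
Qed.

Lemma cnormZ_le a f : cnorm (a *: f) <= cabs a * cnorm f.
Proof.
apply: cnorm_le => [|x]; first by rewrite mulr_ge0 ?cabs_ge0 ?cnorm_ge0.
by rewrite completionE_Z cabsM -mulrA ler_wpM2l ?cabs_ge0 ?le_cnorm.
Qed.

Lemma completion_normZ a f :
  completion_norm (a *: f) = `|a| * completion_norm f.
Proof.
rewrite /completion_norm cabsE -rmorphM; congr (_%:C)%C.
apply/eqP; rewrite eq_le cnormZ_le andTb.
have [->|a0] := eqVneq a 0; first by rewrite cabs0 mul0r cnorm_ge0.
have := cnormZ_le a^-1 (a *: f).
rewrite scalerA mulVf// scale1r => h.
rewrite (le_trans (ler_wpM2l (cabs_ge0 a) h))// mulrA -cabsM mulfV//.
by rewrite cabs1 mul1r.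
Qed.

Lemma completion_norm0_eq0 f : completion_norm f = 0 -> f = 0.
Proof.
move=> /complexI f0; apply: completion_ext => x; apply: cabs_eq0.
by apply/eqP; rewrite eq_le cabs_ge0 (le_trans (le_cnorm f x))// f0 mul0r.
Qed.

HB.instance Definition _ := Lmodule_isNormed.Build R[i] completion
  completion_normD completion_normZ completion_norm0_eq0.

Lemma le_rnorm_completion f x : cabs (f x) <= rnorm f * snorm s x.
Proof. exact: le_cnorm. Qed.

Lemma rnorm_completion_le f M : 0 <= M ->
  (forall x, cabs (f x) <= M * snorm s x) -> rnorm f <= M.
Proof. exact: cnorm_le. Qed.

Lemma mk_completion (f : E -> R[i]) (M : R) : 0 <= M ->
    (forall a x y, f (a *: x + y) = a^* * f x + f y) ->
    (forall x, cabs (f x) <= M * snorm s x) ->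
  f \in bounded_conj.
Proof. by move=> M0 fP fM; apply/asboolP; split=> //; exists M. Qed.

Lemma hat_subproof x : (fun y => s x y) \in bounded_conj.
Proof.
apply: (@mk_completion _ (snorm s x)) => [|a y z|y]; first exact: snorm_ge0.
  by rewrite sipDr sipZr.
exact: cauchy_schwarz.
Qed.

Definition hat x : completion := Completion (hat_subproof x).

Lemma hatE x y : hat x y = s x y. Proof. by []. Qed.

Lemma hat_lin : linear hat.
Proof.
move=> a x y; apply: completion_ext => z.
by rewrite completionE_D completionE_Z !hatE sipPl.
Qed.

Lemma hatB x y : hat (x - y) = hat x - hat y.
Proof. by rewrite addrC -scaleN1r hat_lin scaleN1r addrC. Qed.

Lemma rnorm_hat x : rnorm (hat x) = snorm s x.
Proof.
apply/eqP; rewrite eq_le; apply/andP; split.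
  by apply: rnorm_completion_le; [exact: snorm_ge0|exact: cauchy_schwarz].
have [->|p0] := eqVneq (snorm s x) 0; first exact: rnorm_ge0.
have pgt0 : 0 < snorm s x by rewrite lt0r p0 snorm_ge0.
rewrite -(ler_pM2r pgt0) -expr2 (le_trans _ (le_rnorm_completion _ _))//.
by rewrite hatE sip_snorm cabs_real ger0_norm// exprn_ge0// snorm_ge0.
Qed.

(** The near representatives of the functional [y |-> (f y)^*] approximate [f]. *)
Lemma hat_dense f (e : R) : 0 < e -> exists x, rnorm (f - hat x) <= e.
Proof.
move=> e0; have [||||//|x _ xf] := @near_riesz _ _ s setT (fun y => (f y)^*) (rnorm f) e.
- by [].
- by [].
- by move=> a x y _ _; rewrite completion_lin rmorphD rmorphM /= conjCK.
- by move=> x _; rewrite cabsJ le_rnorm_completion.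
exists x; rewrite rnormB; apply: rnorm_completion_le => [|y]; first exact: ltW.
have := xf y I; rewrite completionE_B hatE -[in X in _ -> X]cabsJ.
by rewrite rmorphB /= -sipC.
Qed.

Lemma completion_seq_complete (u : nat -> completion) :
  cauchy_seq u -> exists l, tends_to u l.
Proof.
move=> uc.
have upt x : cauchy_seq (fun n => u n x).
  move=> e e0; have e1 : 0 < e / (snorm s x + 1).
    by rewrite divr_gt0// ltr_wpDl// snorm_ge0.
  have [N uN] := uc _ e1; exists N => m n Nm Nn.
  have := uN _ _ Nm Nn; rewrite ler_pdivlMr ?ltr_wpDl ?snorm_ge0// => h.
  rewrite -completionE_B (le_trans (le_rnorm_completion _ _))//.
  by rewrite (le_trans _ h)// ler_wpM2l ?rnorm_ge0// lerDl.
have [l ul] := choice (fun x => cauchy_seq_complex (upt x)).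
have lP a x y : l (a *: x + y) = a^* * l x + l y.
  apply: (tends_to_unique (ul _)).
  suff -> : (fun n => u n (a *: x + y)) = (fun n => a^* *: u n x + u n y).
    exact: tends_toP.
  by apply/funext => n; rewrite completion_lin.
have unif e : 0 < e -> exists N, forall n, (N <= n)%N ->
    forall x, cabs (u n x - l x) <= e * snorm s x.
  move=> e0; have [N uN] := uc _ e0; exists N => n Nn x.
  rewrite cabsB; apply: (tends_to_le (ul x) (N := N)) => m Nm.
  rewrite -completionE_B (le_trans (le_rnorm_completion _ _))//.
  by rewrite ler_wpM2r ?snorm_ge0// uN.
have [N uN] := unif _ ltr01.
have lb x : cabs (l x) <= (rnorm (u N) + 1) * snorm s x.
  rewrite -[l x](subrK (u N x)) addrC (le_trans (cabsD _ _))// mulrDl.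
  by apply: lerD; [exact: le_rnorm_completion|rewrite cabsB uN].
have M0 : 0 <= rnorm (u N) + 1 by rewrite addr_ge0 ?rnorm_ge0.
exists (Completion (mk_completion M0 lP lb)) => e e0.
have [N' uN'] := unif _ e0; exists N' => n Nn.
apply: rnorm_completion_le => [|x]; first exact: ltW.
by rewrite completionE_B uN'.
Qed.

HB.instance Definition _ := Uniform_isComplete.Build completion
  (fun F FF => @seq_complete _ _ F completion_seq_complete FF).

Definition is_cinner f g (z : R[i]) := exists2 M : R, 0 <= M &
  forall y, rnorm (g - hat y) <= 1 -> cabs (z - f y) <= M * rnorm (g - hat y).

(** This is the limit of [f y] as [hat y] tends to [g], because the inner product
    of [f] with [hat y] has to be [f y]. The linear rate of convergence in
    [is_cinner] characterizes the limit and makes its algebraic properties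
    immediate. *)
Definition cinner f g : R[i] := xget 0 (is_cinner f g).

Lemma is_cinner_unique f g z w : is_cinner f g z -> is_cinner f g w -> z = w.
Proof.
move=> [M M0 zM] [N N0 wN]; apply/eqP; rewrite -subr_eq0; apply/eqP/cabs_eq0/eqP.
rewrite eq_le cabs_ge0 andbT; apply/ler_addgt0Pr => e e0; rewrite add0r.
have d0 : 0 < Num.min 1 (e / (M + N + 1)).
  by rewrite lt_min ltr01 divr_gt0// ltr_wpDl// addr_ge0.
have [y] := hat_dense g d0; rewrite le_min => /andP[y1].
rewrite ler_pdivlMr ?ltr_wpDl ?addr_ge0// => ye.
rewrite -[z](subrK (f y)) -addrA (le_trans (cabsD _ _))//.
have hw : cabs (f y - w) <= N * rnorm (g - hat y) by rewrite cabsB wN.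
rewrite (le_trans (lerD (zM _ y1) hw))//.
rewrite -mulrDl mulrC (le_trans _ ye)//.
by rewrite ler_wpM2l ?rnorm_ge0// lerDl.
Qed.

Lemma is_cinner_ex f g : exists z, is_cinner f g z.
Proof.
have d0 n : 0 < n.+1%:R^-1 :> R by rewrite invr_gt0.
have [y yg] := choice (fun n => hat_dense g (d0 n)).
have fle x x' : cabs (f x - f x') <= rnorm f * rnorm (hat x - hat x').
  by rewrite -completionB -hatB rnorm_hat le_rnorm_completion.
have fc : cauchy_seq (fun n => f (y n)).
  move=> e e0; have e1 : 0 < e / 2 / (rnorm f + 1).
    by rewrite !divr_gt0// ltr_wpDl// rnorm_ge0.
  have [N eN] := inv_succ_small e1; exists N => m n Nm Nn.
  rewrite (le_trans (fle _ _))//.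
  rewrite (le_trans (ler_wpM2l (rnorm_ge0 _) (rnorm_dist _ g _)))//.
  have hm : rnorm (hat (y m) - g) <= e / 2 / (rnorm f + 1).
    by rewrite rnormB (le_trans (yg m))// eN.
  have hn : rnorm (g - hat (y n)) <= e / 2 / (rnorm f + 1).
    by rewrite (le_trans (yg n))// eN.
  rewrite (le_trans (ler_wpM2l (rnorm_ge0 _) (lerD hm hn)))//.
  rewrite -mulrDl -splitr mulrA ler_pdivrMr ?ltr_wpDl ?rnorm_ge0// mulrC.
  by rewrite ler_pM2l// lerDl.
have [z fz] := cauchy_seq_complex fc; exists z.
exists (rnorm f) => [|x _]; first exact: rnorm_ge0.
apply/ler_addgt0Pr => e e0; have e1 : 0 < e / (rnorm f + 1).
  by rewrite divr_gt0// ltr_wpDl// rnorm_ge0.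
have [N eN] := inv_succ_small e1.
apply: (tends_to_le fz (N := N)) => n Nn.
rewrite (le_trans (fle _ _))//.
rewrite (le_trans (ler_wpM2l (rnorm_ge0 _) (rnorm_dist _ g _)))//.
rewrite mulrDr addrC lerD2l rnormB.
have hn : rnorm (g - hat (y n)) <= e / (rnorm f + 1).
  by rewrite (le_trans (yg n))// eN.
rewrite (le_trans (ler_wpM2l (rnorm_ge0 _) hn))//.
rewrite mulrA ler_pdivrMr ?ltr_wpDl ?rnorm_ge0// mulrC.
by rewrite ler_pM2l// lerDl.
Qed.

Lemma cinnerP f g : is_cinner f g (cinner f g).
Proof. exact: (xgetPex 0 (is_cinner_ex f g)). Qed.

Lemma cinnerE f g z : is_cinner f g z -> cinner f g = z.
Proof. exact: is_cinner_unique (cinnerP f g). Qed.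

Lemma cinner_hat f x : cinner f (hat x) = f x.
Proof.
apply: cinnerE; exists (rnorm f) => [|y _]; first exact: rnorm_ge0.
by rewrite -completionB -hatB rnorm_hat le_rnorm_completion.
Qed.

Lemma cinner_scalar g : scalar (cinner^~ g).
Proof.
move=> a f h; apply: cinnerE.
have [M M0 fM] := cinnerP f g; have [N N0 hN] := cinnerP h g.
exists (cabs a * M + N) => [|y y1].
  by rewrite addr_ge0// mulr_ge0 ?cabs_ge0.
rewrite completionE_D completionE_Z opprD addrACA -mulrBr.
rewrite (le_trans (cabsD _ _))// mulrDl cabsM -mulrA.
by rewrite lerD ?hN// ler_wpM2l ?cabs_ge0 ?fM.
Qed.

Lemma snorm_hat_le g y : rnorm (g - hat y) <= 1 -> snorm s y <= rnorm g + 1.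
Proof.
move=> y1; rewrite -rnorm_hat -[hat y](subrK g) addrC.
by rewrite (le_trans (rnormD _ _))// lerD2l rnormB.
Qed.

Lemma cinnerC f g : cinner f g = (cinner g f)^*.
Proof.
suff : is_cinner g f (cinner f g)^* by move=> /cinnerE ->; rewrite conjCK.
have [M M0 zM] := cinnerP f g; exists (rnorm g + 1) => [|x x1].
  by rewrite addr_ge0 ?rnorm_ge0.
apply/ler_addgt0Pr => e e0.
have d0 : 0 < Num.min 1 (e / (M + snorm s x + 1)).
  by rewrite lt_min ltr01 divr_gt0// ltr_wpDl// addr_ge0 ?snorm_ge0.
have [y] := hat_dense g d0; rewrite le_min => /andP[y1].
rewrite ler_pdivlMr ?ltr_wpDl ?addr_ge0 ?snorm_ge0// => ye.
set d := rnorm (g - hat y) in y1 ye.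
have h1 := zM _ y1.
have h2 : cabs (f y - hat x y) <= (rnorm g + 1) * rnorm (f - hat x).
  rewrite -completionE_B (le_trans (le_rnorm_completion _ _))// mulrC.
  by rewrite ler_wpM2r ?rnorm_ge0 ?snorm_hat_le.
have h3 : cabs (hat x y - (g x)^*) <= d * snorm s x.
  rewrite hatE sipC -rmorphB cabsJ -hatE -completionE_B /d rnormB.
  exact: le_rnorm_completion.
rewrite -(conjCK (g x)) -rmorphB cabsJ.
have -> : cinner f g - (g x)^* =
   (cinner f g - f y) + (f y - hat x y) + (hat x y - (g x)^*) by ring.
rewrite (le_trans (cabsD _ _))//.
rewrite (le_trans (lerD (le_trans (cabsD _ _) (lerD h1 h2)) h3))//.
have d00 : 0 <= d by exact: rnorm_ge0.
move: ye; rewrite mulrDr mulr1 mulrDr (mulrC M); lra.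
Qed.

Lemma cinner_norm f : cinner f f = `|f| ^+ 2.
Proof.
rewrite rnormE -rmorphXn /=; apply: cinnerE.
exists (3 * rnorm f + 2) => [|y y1].
  by rewrite addr_ge0// mulr_ge0 ?rnorm_ge0.
set d := rnorm (f - hat y) in y1 *.
have d0 : 0 <= d by exact: rnorm_ge0.
have f0 : 0 <= rnorm f by exact: rnorm_ge0.
have p0 : 0 <= snorm s y by exact: snorm_ge0.
have h1 : cabs (hat y y - f y) <= d * snorm s y.
  by rewrite /d rnormB -completionE_B le_rnorm_completion.
have h2 : rnorm f <= d + snorm s y.
  by rewrite -rnorm_hat -{1}[f](subrK (hat y)) rnormD.
have h3 : snorm s y <= d + rnorm f.
  by rewrite -rnorm_hat -{1}[hat y](subrK f) (le_trans (rnormD _ _))// lerD2r rnormB.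
rewrite -[_ - f y](subrKA (hat y y)) (le_trans (cabsD _ _))//.
rewrite (le_trans (lerD (lexx _) h1))// hatE sip_snorm -rmorphB cabs_real.
have : `|rnorm f ^+ 2 - snorm s y ^+ 2| <= d * (rnorm f + snorm s y).
  rewrite subr_sqr normrM (ger0_norm (addr_ge0 f0 p0)) ler_wpM2r ?addr_ge0//.
  by rewrite ler_norml; apply/andP; split; lra.
nra.
Qed.

Lemma cinner_bilinear : bilinear_for
  ( *%R : GRing.Scale.law R[i] R[i]) (Num.conj \; *%R : GRing.Scale.law R[i] R[i])
  (cinner : completion -> completion -> R[i]).
Proof.
split=> [g|f]; first exact: cinner_scalar.
move=> a g h; rewrite cinnerC cinner_scalar rmorphD rmorphM /=.
by rewrite -!cinnerC.
Qed.

HB.instance Definition _ := bilinear_isBilinear.Build R[i] completion completion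
  R[i] ( *%R) (Num.conj \; *%R) cinner cinner_bilinear.

Lemma cinner_hermitian f g : cinner f g = (-1) ^+ false * (cinner g f)^*.
Proof. by rewrite expr0 mul1r -cinnerC. Qed.

HB.instance Definition _ := isHermitianSesquilinear.Build R[i] completion false
  Num.conj cinner cinner_hermitian.

Lemma cinner_gt0 f : f != 0 -> 0 < cinner f f.
Proof. by move=> f0; rewrite cinner_norm exprn_gt0// normr_gt0. Qed.

HB.instance Definition _ := isDotProduct.Build R[i] completion cinner cinner_gt0.

HB.instance Definition _ := isHilbert.Build R completion cinner_norm.

Lemma inner_hat f x : inner f (hat x) = f x.
Proof. exact: cinner_hat. Qed.

End Completion.

(** * The Hahn-Banach theorem *)

Section HahnBanach.
Variables (R : realType) (V : lmodType R[i]).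
Implicit Types (p q : V -> R) (x y : V) (t c : R).

Lemma le_infD (A B : set R) (z : R) : A !=set0 -> B !=set0 ->
  (forall a b, A a -> B b -> z <= a + b) -> z <= inf A + inf B.
Proof.
move=> A0 B0 zAB; rewrite -lerBlDr; apply: lb_le_inf => // a Aa.
by rewrite lerBlDr -lerBlDl; apply: lb_le_inf => // b Bb; rewrite lerBlDl zAB.
Qed.

(** Applied to the inverse scalar, the second clause gives the reverse
    inequality. *)
Definition sublinear p := (forall x y, p (x + y) <= p x + p y) /\
  (forall t x, 0 < t -> p (t%:C%C *: x) <= t * p x).

Definition real_linear (P : V -> R) := (forall x y, P (x + y) = P x + P y) /\
  (forall t x, P (t%:C%C *: x) = t * P x).

Lemma sublinearZ p t x : sublinear p -> 0 <= t -> p (t%:C%C *: x) = t * p x.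
Proof.
move=> [_ pZ]; rewrite le_eqVlt => /predU1P[<-|t0].
  rewrite scale0r mul0r; apply/eqP; rewrite eq_le.
  have two0 : 0 < 2 :> R by rewrite ltr0n.
  have := pZ 2 0 two0; have := pZ 2^-1 0; rewrite invr_gt0 => /(_ two0).
  by rewrite !scaler0 => h1 h2; apply/andP; split; lra.
apply/eqP; rewrite eq_le pZ//=.
have := pZ t^-1 (t%:C%C *: x); rewrite invr_gt0 => /(_ t0).
rewrite scalerA -rmorphM mulVf ?gt_eqF// scale1r.
by rewrite mulrC ler_pdivlMr// mulrC.
Qed.

Lemma sublinear0 p : sublinear p -> p 0 = 0.
Proof. by move=> /(sublinearZ 0) /(_ (lexx 0)); rewrite scale0r mul0r. Qed.

Lemma sublinearN p x : sublinear p -> - p (- x) <= p x.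
Proof.
move=> ps; have := ps.1 x (- x); rewrite subrr sublinear0//; lra.
Qed.

(** The pointwise infimum of a chain of sublinear functionals is finite since
    [- p (- x)] is a lower bound, and subadditive since two members of the chain
    can be replaced by the smaller one. *)
Lemma chain_inf p (A : set (V -> R)) : A !=set0 ->
    (forall q, A q -> sublinear q /\ forall x, q x <= p x) ->
    (forall q q', A q -> A q' -> (forall x, q x <= q' x) \/ (forall x, q' x <= q x)) ->
  exists2 r, sublinear r & forall q, A q -> forall x, r x <= q x.
Proof.
move=> [q0 Aq0] Ap Ac; pose S x := [set q x | q in A].
have S0 x : S x !=set0 by exists (q0 x), q0.
have Slb x : has_lbound (S x).
  exists (- p (- x)) => _ [q Aq <-]; have [qs qp] := Ap _ Aq.
  by rewrite (le_trans _ (sublinearN _ qs))// lerN2.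
have rle q x : A q -> inf (S x) <= q x by move=> Aq; apply: ge_inf => //; exists q.
exists (fun x => inf (S x)) => [|q Aq x]; last exact: rle.
split=> [x y|t x t0].
  apply: le_infD => // _ _ [q Aq <-] [q' Aq' <-].
  have [qq'|q'q] := Ac _ _ Aq Aq'.
    by rewrite (le_trans (rle q _ Aq))// (le_trans ((Ap _ Aq).1.1 _ _))// lerD2l.
  by rewrite (le_trans (rle q' _ Aq'))// (le_trans ((Ap _ Aq').1.1 _ _))// lerD2r.
rewrite -ler_pdivrMl//; apply: lb_le_inf => // _ [q Aq <-].
by rewrite ler_pdivrMl// (le_trans (rle q _ Aq))// (Ap _ Aq).1.2.
Qed.

(** The infimum over [t >= 0] of [q (y + t x) - t q x]. If [q] is minimal, it is
    equal to this lowered functional, hence superadditive along [x]. *)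
Lemma sublinear_slope q x : sublinear q -> exists r,
  [/\ sublinear r, forall y, r y <= q y & forall y, r y <= q (y + x) - q x].
Proof.
move=> qs; pose S y := [set q (y + t%:C%C *: x) - t * q x | t in [set t | 0 <= t]].
have S0 y : S y !=set0 by exists (q (y + 0%:C%C *: x) - 0 * q x), 0 => //=.
have Slb y : has_lbound (S y).
  exists (- q (- y)) => _ [t /= t0 <-]; have := qs.1 (y + t%:C%C *: x) (- y).
  by rewrite addrC addrA addNr add0r sublinearZ//; lra.
have rle y t : 0 <= t -> inf (S y) <= q (y + t%:C%C *: x) - t * q x.
  by move=> t0; apply: ge_inf => //; exists t.
exists (fun y => inf (S y)); split=> [|y|y].
- split=> [y z|c y c0].
    apply: le_infD => // _ _ [t /= t0 <-] [t' /= t'0 <-].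
    rewrite (le_trans (rle _ (t + t') _)) ?addr_ge0//.
    have := qs.1 (y + t%:C%C *: x) (z + t'%:C%C *: x).
    by rewrite addrACA -scalerDl -rmorphD; lra.
  rewrite -ler_pdivrMl//; apply: lb_le_inf => // _ [t /= t0 <-].
  rewrite ler_pdivrMl// (le_trans (rle _ (c * t) _)) ?mulr_ge0 ?(ltW c0)//.
  by rewrite rmorphM -scalerA -scalerDr sublinearZ ?(ltW c0)// mulrBr mulrA.
- by have := rle y 0 (lexx 0); rewrite scale0r addr0 mul0r subr0.
- by have := rle y 1 ler01; rewrite scale1r mul1r.
Qed.

(** Linear functionals are the minimal sublinear functionals, and Zorn's lemma
    provides a minimal one below [p]. *)
Theorem hahn_banach p : sublinear p ->
  exists2 P, real_linear P & forall x, P x <= p x.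
Proof.
move=> ps; pose T := {q | sublinear q /\ forall x, q x <= p x}.
pose below (q q' : T) := `[< forall x, sval q' x <= sval q x >].
have [|||A Ac|q qmin] := @Zorn T below.
- by move=> q; apply/asboolP.
- move=> q q' q'' /asboolP h /asboolP h'; apply/asboolP => x.
  exact: le_trans (h' x) (h x).
- move=> [q hq] [q' hq'] /asboolP h /asboolP h'; apply: eq_exist => /=.
  by apply/funext => x; apply/eqP; rewrite eq_le (h x) (h' x).
- have [[q Aq]|A0] := pselect (A !=set0); last first.
    exists (exist _ p (conj ps (fun x => lexx _))) => q Aq; apply/asboolP.
    by exfalso; apply: A0; exists q.
  have [|||r rs rA] := @chain_inf p [set sval q | q in A].
  + by exists (sval q), q.
  + by move=> _ [s As <-]; exact: svalP s.
  + move=> _ _ [s1 As <-] [s2 As' <-].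
    by have [] := Ac _ _ As As' => /asboolP ?; [right|left].
  have rp x : r x <= p x.
    by rewrite (le_trans (rA (sval q) _ x))//; [exists q|exact: (svalP q).2].
  exists (exist _ r (conj rs rp)) => s As; apply/asboolP => x /=.
  by apply: rA; exists s.
case: q qmin => q [qs qp] qmin.
have qD x y : q (x + y) = q x + q y.
  apply/eqP; rewrite eq_le qs.1/=.
  have [r [rs rq rx]] := sublinear_slope y qs.
  have rp z : r z <= p z by exact: le_trans (rq z) (qp z).
  have := qmin (exist _ r (conj rs rp)) (asboolT rq) => -[rE].
  by have := rx x; rewrite rE; lra.
exists q => //; split=> // t x; have [t0|t0] := leP 0 t; first exact: sublinearZ.
have qN z : q (- z) = - q z.
  by have := qD z (- z); rewrite subrr sublinear0//; lra.
rewrite -[t]opprK rmorphN scaleNr qN sublinearZ ?mulNr// oppr_ge0 ltW//.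
Qed.

End HahnBanach.

(** * Matrix norms and the dual numerical radius Haagerup norm *)

Section L2norm.
Variables (R : realType).

Section OneSpace.
Variables (V : normedModType R[i]) (n : nat).
Implicit Types h : 'I_n -> V.

Lemma l2norm_ge0 h : 0 <= l2norm h. Proof. exact: sqrtr_ge0. Qed.

Lemma l2norm_sqr h : l2norm h ^+ 2 = \sum_i rnorm (h i) ^+ 2.
Proof. by rewrite sqr_sqrtr// sumr_ge0// => i _; exact: sqr_ge0. Qed.

Lemma l2norm_le h (C : R) : 0 <= C ->
  (l2norm h <= C) = (\sum_i rnorm (h i) ^+ 2 <= C ^+ 2).
Proof. by move=> C0; rewrite -l2norm_sqr ler_pXn2r ?nnegrE ?l2norm_ge0. Qed.

Lemma rnorm_le_l2norm h i : rnorm (h i) <= l2norm h.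
Proof.
rewrite -(@ler_pXn2r _ 2) ?nnegrE ?rnorm_ge0 ?l2norm_ge0// l2norm_sqr.
by rewrite (bigD1 i)//= lerDl sumr_ge0// => j _; exact: sqr_ge0.
Qed.

Lemma l2norm_le_sum h : l2norm h <= \sum_i rnorm (h i).
Proof.
have s0 (r : seq 'I_n) : 0 <= \sum_(i <- r) rnorm (h i).
  by rewrite sumr_ge0// => i _; exact: rnorm_ge0.
rewrite l2norm_le//; elim: (index_enum _) => [|i r IH].
  by rewrite !big_nil expr0n.
rewrite !big_cons sqrrD -addrA lerD2l (le_trans IH)// lerDr.
by rewrite mulrn_wge0// mulr_ge0 ?rnorm_ge0.
Qed.

Lemma l2normZ (t : R[i]) h : l2norm (fun i => t *: h i) = cabs t * l2norm h.
Proof.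
apply/eqP; rewrite -(@eqrXn2 _ 2) ?l2norm_ge0 ?mulr_ge0 ?cabs_ge0 ?l2norm_ge0//.
rewrite exprMn !l2norm_sqr mulr_sumr; apply/eqP; apply: eq_bigr => i _.
by rewrite rnormZ_cabs exprMn.
Qed.

Lemma l2norm0 : l2norm (fun _ : 'I_n => 0 : V) = 0.
Proof.
by rewrite /l2norm big1 ?sqrtr0// => i _; rewrite rnorm0 expr0n.
Qed.

End OneSpace.

Section Maps.
Variables (V W : normedModType R[i]) (m n : nat).
Variable F : ('I_n -> V) -> ('I_m -> W).

Let N := map_norm (@l2norm R V n) (@l2norm R W m) F.

Lemma map_norm_le C : 0 <= C ->
  (forall h, l2norm (F h) <= C * l2norm h) -> N <= C.
Proof.
move=> C0 FC; apply: ge_sup.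
  by exists (l2norm (F (fun=> 0))), (fun=> 0) => //=; rewrite l2norm0.
by move=> _ [h /= h1 <-]; rewrite (le_trans (FC h))// ler_piMr.
Qed.

Lemma map_norm_ge0 : 0 <= N.
Proof.
rewrite /N /map_norm; have [/sup_upper_bound ub|/sup_out ->//] := pselect (has_sup
  [set l2norm (F h) | h in [set h | l2norm h <= 1]]).
apply: (le_trans (l2norm_ge0 (F (fun=> 0)))).
by apply: ub; exists (fun=> 0) => //=; rewrite l2norm0.
Qed.

Hypothesis FZ : forall (t : R[i]) h, F (fun i => t *: h i) = fun i => t *: F h i.

Lemma le_map_norm M : (forall h, l2norm (F h) <= M * l2norm h) ->
  forall h, l2norm (F h) <= N * l2norm h.
Proof.
move=> FM h.
have Nsup : has_sup [set l2norm (F h) | h in [set h | l2norm h <= 1]].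
  split; first by exists (l2norm (F (fun=> 0))), (fun=> 0) => //=; rewrite l2norm0.
  exists `|M| => _ [x /= x1 <-]; rewrite (le_trans (FM x))//.
  rewrite (le_trans (ler_norm _))// normrM ler_piMr// ger0_norm//.
  exact: l2norm_ge0.
have [h0|h0] := eqVneq (l2norm h) 0.
  by rewrite (le_trans (FM h))// h0 !mulr0.
have hgt0 : 0 < l2norm h by rewrite lt0r h0 l2norm_ge0.
have c : cabs ((l2norm h)^-1%:C%C : R[i]) = (l2norm h)^-1.
  by rewrite cabs_real ger0_norm// invr_ge0 l2norm_ge0.
rewrite -ler_pdivrMr// mulrC -c -l2normZ -FZ; apply: sup_upper_bound => //.
by exists (fun i => (l2norm h)^-1%:C%C *: h i) => //=; rewrite l2normZ c mulVf.
Qed.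

End Maps.

(** The crude bound by the sum of the norms of the entries ensures that the
    suprema defining the matrix norms are finite. *)
Lemma matrix_map_bounded (V W : normedModType R[i]) m n
    (X : 'I_m -> 'I_n -> V -> W) (M : 'I_m -> 'I_n -> R) :
    (forall i j x, rnorm (X i j x) <= M i j * rnorm x) ->
    (forall i j, 0 <= M i j) ->
  forall h : 'I_n -> V,
    l2norm (fun i => \sum_j X i j (h j)) <= (\sum_i \sum_j M i j) * l2norm h.
Proof.
move=> XM M0 h; rewrite (le_trans (l2norm_le_sum _))// mulr_suml.
apply: ler_sum => i _; rewrite mulr_suml.
elim/big_rec2: _ => [|j x y _ xy]; first by rewrite rnorm0.
rewrite (le_trans (rnormD _ _))// lerD// (le_trans (XM _ _ _))//.
by rewrite ler_wpM2l// rnorm_le_l2norm.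
Qed.

Lemma le_opmx_norm (H : hilbertType R) m n (X : 'M['B(H)]_(m, n)) (h : 'I_n -> H) :
  l2norm (fun i => \sum_j X i j (h j)) <= opmx_norm X * l2norm h.
Proof.
have FM := @matrix_map_bounded _ _ _ _ (fun i j => X i j)
  (fun i j => rnorm (X i j)) (fun i j => rnorm_blin_le (X i j))
  (fun i j => rnorm_ge0 (X i j)).
apply: (le_map_norm _ FM) => t k; apply/funext => i.
by rewrite scaler_sumr; apply: eq_bigr => j _; rewrite blinZ.
Qed.

Lemma opmx_norm_ge0 (H : hilbertType R) m n (X : 'M['B(H)]_(m, n)) :
  0 <= opmx_norm X.
Proof. exact: map_norm_ge0. Qed.

Lemma column_norm_ge0 (K : hilbertType R) n (xi : 'M[K]_n) : 0 <= column_norm xi.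
Proof. exact: map_norm_ge0. Qed.

Lemma le_column_norm (K : hilbertType R) n (xi : 'M[K]_n) (l : 'I_n -> R[i]^o) :
  l2norm (fun i => \sum_j l j *: xi i j) <= column_norm xi * l2norm l.
Proof.
have FM := @matrix_map_bounded _ _ _ _ (fun i j (a : R[i]^o) => a *: xi i j)
  (fun i j => rnorm (xi i j)) _ (fun i j => rnorm_ge0 (xi i j)).
apply: (le_map_norm _ (FM _)) => [t k|i j x].
  apply/funext => i; rewrite scaler_sumr; apply: eq_bigr => j _.
  by rewrite scalerA.
by rewrite rnormZ_cabs mulrC.
Qed.

End L2norm.

Section WH.
Variables (R : realType) (H : hilbertType R) (A : submodClosed 'B(H)).
Local Notation V := (subspace_of A).
Variable T : {biscalar V}.

(** The square of the norm at [h] of the column of the [x^*] and the [y]. *)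
Definition col_sqr (x y : V) (h : H) : R :=
  rnorm (adjoint (val x) h) ^+ 2 + rnorm (val y h) ^+ 2.

Lemma col_sqr_ge0 x y h : 0 <= col_sqr x y h.
Proof. by rewrite addr_ge0 ?sqr_ge0. Qed.

Lemma col_sqrZ (a : R[i]) x y h :
  col_sqr (a *: x) (a *: y) h = cabs a ^+ 2 * col_sqr x y h.
Proof.
have valZ (z : V) : val (a *: z) = a *: val z by exact: linearZ.
rewrite /col_sqr mulrDr -!exprMn; congr (_ ^+ 2 + _ ^+ 2).
  by rewrite valZ adjointZ blinE_Z rnormZ_cabs cabsJ.
by rewrite valZ blinE_Z rnormZ_cabs.
Qed.

Section Row.
Variables (n : nat) (x y : 'I_n -> V).

Definition wh_row : 'M['B(H)]_(1, n + n) :=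
  row_mx (\row_i val (x i)) (\row_i adjoint (val (y i))).

Let c (j : 'I_(n + n)) : 'B(H) :=
  match fintype.split j with inl i => adjoint (val (x i)) | inr i => val (y i) end.

Let wh_rowE j : wh_row 0 j = adjoint (c j).
Proof.
by rewrite /wh_row /c mxE; case: fintype.split => i; rewrite mxE// adjointK.
Qed.

Let sum_c h : \sum_j rnorm (c j h) ^+ 2 = \sum_i col_sqr (x i) (y i) h.
Proof.
rewrite big_split_ord /= /col_sqr big_split /=; congr (_ + _);
  apply: eq_bigr => i _; rewrite /c.
  by rewrite -[lshift n i]/(unsplit (inl i)) unsplitK.
by rewrite -[rshift n i]/(unsplit (inr i)) unsplitK.
Qed.

(** A row and its adjoint column have the same norm; this is the inequality that
    bounds the row, obtained by pairing the image of the row with itself. *)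
Lemma wh_row_le (C : R) : 0 <= C ->
    (forall h, \sum_i col_sqr (x i) (y i) h <= C ^+ 2 * rnorm h ^+ 2) ->
  opmx_norm wh_row <= C.
Proof.
move=> C0 xyC; apply: map_norm_le => // h.
rewrite l2norm_le ?mulr_ge0 ?l2norm_ge0// big_ord1.
under eq_bigr do rewrite wh_rowE.
set k := \sum_j _; rewrite ler_pXn2r ?nnegrE ?mulr_ge0 ?l2norm_ge0 ?rnorm_ge0//.
have [->|k0] := eqVneq (rnorm k) 0; first by rewrite mulr_ge0 ?l2norm_ge0.
have kgt0 : 0 < rnorm k by rewrite lt0r k0 rnorm_ge0.
have kk : rnorm k ^+ 2 <= \sum_j rnorm (h j) * rnorm (c j k).
  rewrite -[rnorm k ^+ 2]ger0_norm ?exprn_ge0 ?rnorm_ge0// -cabs_real.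
  rewrite -inner_rnorm {1}/k inner_suml.
  elim/big_rec2: _ => [|j u v _ uv]; first by rewrite cabs0.
  by rewrite (le_trans (cabsD _ _))// lerD// adjointPr inner_le.
rewrite -(ler_pM2r kgt0) -expr2 (le_trans kk)//.
rewrite -(@ler_pXn2r _ 2)// ?nnegrE; last 2 first.
- by rewrite sumr_ge0// => j _; rewrite mulr_ge0 ?rnorm_ge0.
- by rewrite !mulr_ge0 ?l2norm_ge0 ?rnorm_ge0.
rewrite (le_trans (sum_cauchy_schwarz _ _ _))// -l2norm_sqr sum_c.
rewrite (le_trans (ler_wpM2l (sqr_ge0 _) (xyC k)))//.
by rewrite !exprMn mulrA (mulrC (C ^+ 2)).
Qed.

(** The opposite inequality: the row is applied to the image of the column. *)
Lemma wh_row_ge h :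
  \sum_i col_sqr (x i) (y i) h <= opmx_norm wh_row ^+ 2 * rnorm h ^+ 2.
Proof.
set N := opmx_norm _; have N0 : 0 <= N by exact: opmx_norm_ge0.
rewrite -sum_c -l2norm_sqr -exprMn; set k : 'I_(n + n) -> H := fun j => c j h.
rewrite ler_pXn2r ?nnegrE ?mulr_ge0 ?l2norm_ge0 ?rnorm_ge0//.
have [->|k0] := eqVneq (l2norm k) 0; first by rewrite mulr_ge0 ?rnorm_ge0.
have kgt0 : 0 < l2norm k by rewrite lt0r k0 l2norm_ge0.
rewrite -(ler_pM2r kgt0) -expr2 l2norm_sqr.
have -> : \sum_j rnorm (k j) ^+ 2 = cabs (inner h (\sum_j wh_row 0 j (k j))).
  rewrite innerC cabsJ inner_suml.
  under [X in cabs X]eq_bigr => j _ do rewrite wh_rowE adjointPr -/(k j) inner_rnorm.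
  rewrite -rmorph_sum cabs_real ger0_norm//.
  by rewrite sumr_ge0// => j _; exact: sqr_ge0.
rewrite (le_trans (inner_le _ _))// mulrAC mulrC ler_wpM2r ?rnorm_ge0//.
apply: le_trans (le_opmx_norm wh_row k).
exact: (rnorm_le_l2norm (fun i => \sum_j wh_row i j (k j)) 0).
Qed.

End Row.

(** The half in the definition of the norm becomes the factor two in the bound on
    the column. *)
Definition wh_dominated := forall n (x y : 'I_n -> V) (C : R), 0 <= C ->
  (forall h, \sum_i col_sqr (x i) (y i) h <= 2 * C * rnorm h ^+ 2) ->
  cabs (\sum_i T (x i) (y i)) <= C.

Lemma sum_elem_tensor n (x y : 'I_n -> V) :
  (\sum_i elem_tensor (x i) (y i)) T = \sum_i T (x i) (y i).
Proof. by rewrite fct_sumE. Qed.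

Lemma wh_norm_lb (u : {biscalar V} -> R[i]) : has_lbound [set r | exists n (x y : 'I_n -> V),
    u = \sum_i elem_tensor (x i) (y i) /\
    r = 2^-1 * opmx_norm (row_mx (\row_i val (x i))
                                 (\row_i adjoint (val (y i)))) ^+ 2].
Proof.
exists 0 => _ [n [x [y [_ ->]]]].
by rewrite mulr_ge0 ?exprn_ge0 ?opmx_norm_ge0.
Qed.

(** Rescaling both factors of a tensor by a common real number turns the bound on
    the unit ball into a homogeneous inequality. *)
Lemma wh_dualP : (wh_dual_norm T <= 1)%E <-> wh_dominated.
Proof.
split=> [T1 n x y C C0 xyC|Tdom]; last first.
  apply: ge_ereal_sup => _ [u [[n0 [x0 [y0 u0]]] u1] <-]; rewrite lee_fin.
  apply/ler_addgt0Pr => e e0.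
  have hi : has_inf [set r | exists n (x y : 'I_n -> V),
      u = \sum_i elem_tensor (x i) (y i) /\
      r = 2^-1 * opmx_norm (wh_row x y) ^+ 2].
    split; last exact: wh_norm_lb.
    by exists (2^-1 * opmx_norm (wh_row x0 y0) ^+ 2), n0, x0, y0.
  have [_ [n [x [y [uE ->]]]] re] := inf_adherent e0 hi.
  have {}re := lt_le_trans re (lerD u1 (lexx e)).
  rewrite uE sum_elem_tensor -/(cabs _); apply: (le_trans _ (ltW re)).
  apply: Tdom => [|h]; first by rewrite mulr_ge0 ?exprn_ge0 ?opmx_norm_ge0.
  by rewrite (mulrA 2) mulfV ?mul1r ?wh_row_ge// pnatr_eq0.
apply/ler_addgt0Pr => e e0; set C' := C + e.
have C'0 : 0 < C' by rewrite ltr_wpDl.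
pose t : R[i] := (Num.sqrt C'^-1)%:C%C.
have tt : t * t = C'^-1%:C%C.
  by rewrite -rmorphM /= -expr2 sqr_sqrtr// invr_ge0 ltW.
have ct : cabs t ^+ 2 = C'^-1.
  by rewrite cabs_real -normrX sqr_sqrtr ?invr_ge0 ?(ltW C'0)// ger0_norm// invr_ge0 ltW.
pose x' i := t *: x i; pose y' i := t *: y i.
pose u : {biscalar V} -> R[i] := \sum_i elem_tensor (x' i) (y' i).
have row_le : opmx_norm (wh_row x' y') <= Num.sqrt 2.
  apply: wh_row_le => [|h]; first exact: sqrtr_ge0.
  rewrite sqr_sqrtr//; under eq_bigr do rewrite col_sqrZ ct.
  rewrite -mulr_sumr ler_pdivrMl//; apply: le_trans (xyC h) _.
  by rewrite (mulrA C') (mulrC C') ler_wpM2r ?exprn_ge0 ?rnorm_ge0// ler_wpM2l// lerDl ltW.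
have u1 : wh_norm u <= 1.
  apply: (@le_trans _ _ (2^-1 * opmx_norm (wh_row x' y') ^+ 2)).
    by apply: ge_inf; [exact: wh_norm_lb|exists n, x', y'].
  rewrite ler_pdivrMl// mulr1 -[leRHS]sqr_sqrtr//.
  by rewrite ler_pXn2r ?nnegrE ?opmx_norm_ge0 ?sqrtr_ge0.
have uT : u T = C'^-1%:C%C * \sum_i T (x i) (y i).
  rewrite /u sum_elem_tensor mulr_sumr; apply: eq_bigr => i _.
  by rewrite linearZl_LR linearZr_LR /= mulrA tt.
have : ((cabs (u T))%:E <= 1)%E.
  by rewrite (le_trans _ T1)//; apply: ereal_sup_ubound; exists u => //;
    split=> //; exists n, x', y'.
rewrite lee_fin uT cabsM cabs_real ger0_norm ?invr_ge0 ?(ltW C'0)//.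
by rewrite ler_pdivrMl// mulr1.
Qed.

End WH.

(** * The dominating unital positive functional *)

Section Dominating.
Variables (R : realType) (H : hilbertType R).

Lemma blin_id_subproof : (fun x : H => x) \in @bounded_linear R H H.
Proof. by apply/asboolP; split=> //; exists 1 => x; rewrite mul1r. Qed.

Definition blin_id : 'B(H) := Blin blin_id_subproof.

(** Unital positive functionals on all bounded operators. Positivity is tested
    on operators with positive numerical range, which makes
    [a^* a <= |a|^2] immediate. *)
Definition unital_positive (phi : 'B(H) -> R[i]) :=
  [/\ scalar phi, forall w, phi (adjoint w) = (phi w)^*,
      forall w : 'B(H), (forall h, 0 <= complex.Re (inner (w h) h)) ->
        0 <= complex.Re (phi w) & phi blin_id = 1].

Variables (A : submodClosed 'B(H)).
Local Notation V := (subspace_of A).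
Variable T : {biscalar V}.

Lemma wh_dominated_seq (r : seq (V * V)) (C : R) : wh_dominated T -> 0 <= C ->
  (forall h, \sum_(p <- r) col_sqr p.1 p.2 h <= 2 * C * rnorm h ^+ 2) ->
  cabs (\sum_(p <- r) T p.1 p.2) <= C.
Proof.
move=> Tdom C0 rC; rewrite big_tnth.
by apply: Tdom => // h; have := rC h; rewrite big_tnth.
Qed.

Let tau (r : seq (V * V)) : R[i] := \sum_(p <- r) T p.1 p.2.
Let col (r : seq (V * V)) h : R := \sum_(p <- r) col_sqr p.1 p.2 h.

(** If a unital positive functional [P] satisfies
    [Re (T x y) <= P (x x^* + y^* y) / 2] for all [x] and [y], then [P w] is at
    most every [t] in this set. *)
Let upper (w : 'B(H)) : set R := [set t | exists r, forall h,
  complex.Re (inner (w h) h) + 2^-1 * col r h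
    <= (t + complex.Re (tau r)) * rnorm h ^+ 2].

Let wh_functional w := inf (upper w).

Lemma Re_inner_le (w : 'B(H)) h :
  complex.Re (inner (w h) h) <= rnorm w * rnorm h ^+ 2.
Proof.
rewrite (le_trans (Re_le_cabs _))// (le_trans (inner_le _ _))//.
by rewrite expr2 mulrA ler_wpM2r ?rnorm_ge0 ?rnorm_blin_le.
Qed.

Let col_nil h : col [::] h = 0. Proof. by rewrite /col big_nil. Qed.
Let tau_nil : tau [::] = 0. Proof. by rewrite /tau big_nil. Qed.

Let upper_nil (w : 'B(H)) (t : R) : (forall h, complex.Re (inner (w h) h) <= t * rnorm h ^+ 2) ->
  upper w t.
Proof.
by move=> wt; exists [::] => h; rewrite col_nil tau_nil mulr0 !addr0.
Qed.

Let upper0 w : upper w !=set0.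
Proof. by exists (rnorm w); apply: upper_nil => h; exact: Re_inner_le. Qed.

Hypothesis Tdom : wh_dominated T.
Variable h0 : H.
Hypothesis h0_neq0 : h0 != 0.

Let h0_gt0 : 0 < rnorm h0 ^+ 2.
Proof.
rewrite exprn_gt0// lt0r rnorm_ge0 andbT; apply: contra h0_neq0.
by move=> /eqP/rnorm_eq0 ->.
Qed.

Let upper_lb w : lbound (upper w) (- rnorm w).
Proof.
move=> t [r rt]; set C := t + complex.Re (tau r) + rnorm w.
have colC h : col r h <= 2 * C * rnorm h ^+ 2.
  have := rt h; have : - complex.Re (inner (w h) h) <= rnorm w * rnorm h ^+ 2.
    have := Re_inner_le (- w) h.
    by rewrite blinE_N innerNl ReN rnormN.
  rewrite /C; lra.
have C0 : 0 <= C.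
  have := colC h0; have : 0 <= col r h0.
    by rewrite sumr_ge0// => p _; exact: col_sqr_ge0.
  by move=> h /(le_trans h); rewrite pmulr_lge0// pmulr_rge0.
have := wh_dominated_seq Tdom C0 colC.
by move=> /(le_trans (Re_le_cabs _)); rewrite -/(tau r) /C; lra.
Qed.

Let le_upper w t : upper w t -> wh_functional w <= t.
Proof. by move=> wt; apply: ge_inf => //; exists (- rnorm w). Qed.

Let wh_sublinear : sublinear wh_functional.
Proof.
split=> [w w'|t w t0].
  apply: le_infD => // a b [r ra] [r' rb]; apply: le_upper; exists (r ++ r') => h.
  have := ra h; have := rb h; rewrite blinE_D innerDl.
  by rewrite /tau /col !big_cat /= !ReD; lra.
rewrite -ler_pdivrMl//; apply: lb_le_inf => // a [r ra].
rewrite ler_pdivrMl//; apply: le_upper.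
pose s : R[i] := (Num.sqrt t)%:C%C.
have ss : s * s = t%:C%C by rewrite -rmorphM /= -expr2 sqr_sqrtr// ltW.
have cs : cabs s ^+ 2 = t.
  by rewrite cabs_real -normrX sqr_sqrtr ?(ltW t0)// ger0_norm// ltW.
exists [seq (s *: p.1, s *: p.2) | p <- r] => h.
have -> : col [seq (s *: p.1, s *: p.2) | p <- r] h = t * col r h.
  by rewrite /col big_map mulr_sumr; apply: eq_bigr => p _; rewrite col_sqrZ cs.
have -> : tau [seq (s *: p.1, s *: p.2) | p <- r] = t%:C%C * tau r.
  rewrite /tau big_map mulr_sumr; apply: eq_bigr => p _.
  by rewrite linearZl_LR linearZr_LR /= mulrA ss.
rewrite blinE_Z innerZl !Re_scale -mulrDr -mulrA mulrCA -mulrDr.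
by rewrite ler_wpM2l ?(ltW t0)// ra.
Qed.

(** A linear functional below [wh_functional] is positive and unital because the
    empty family bounds it by the numerical range, and it dominates [T] because
    of the families with one term. The families with several terms make
    [wh_functional] subadditive. *)
Lemma dominating_functional : exists phi, unital_positive phi /\
  forall x y : V, cabs (T x y) ^+ 2 <=
    complex.Re (phi (val x ∘ adjoint (val x))) *
    complex.Re (phi (adjoint (val y) ∘ val y)).
Proof.
have [P [PD PZ] Ple] := hahn_banach wh_sublinear.
have P_le w t : upper w t -> P w <= t.
  by move=> wt; rewrite (le_trans (Ple w))// le_upper.
have PN w : P (- w) = - P w.
  by have := PZ (-1) w; rewrite rmorphN1 scaleN1r mulN1r.
have Ppos (w : 'B(H)) : (forall h, 0 <= complex.Re (inner (w h) h)) -> 0 <= P w.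
  move=> w0; rewrite -oppr_le0 -PN; apply/P_le/upper_nil => h.
  by rewrite blinE_N innerNl ReN mul0r oppr_le0.
have Pskew (w : 'B(H)) : (forall h, complex.Re (inner (w h) h) = 0) -> P w = 0.
  move=> w0; apply/eqP; rewrite eq_le Ppos ?andbT => [|h]; last by rewrite w0.
  rewrite -oppr_ge0 -PN; apply: Ppos => h.
  by rewrite blinE_N innerNl ReN w0 oppr0.
(* the complex linear functional with real part [P] *)
pose phi (w : 'B(H)) : R[i] := (P w +i* - P ('i%C *: w))%C.
have phi_scalar : scalar phi.
  move=> [a b] w v; rewrite /phi.
  have cE : (a +i* b)%C = a%:C%C + 'i%C * b%:C%C :> R[i] by exact: complexE.
  have cw u : P ((a +i* b)%C *: u) = a * P u + b * P ('i%C *: u).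
    by rewrite cE scalerDl PD PZ ['i%C * _]mulrC -scalerA PZ.
  have iiw : P ('i%C *: ('i%C *: w)) = - P w.
    by rewrite scalerA -expr2 sqr_i scaleN1r PN.
  have e1 : P ((a +i* b)%C *: w + v) = a * P w + b * P ('i%C *: w) + P v.
    by rewrite PD cw.
  have e2 : P ('i%C *: ((a +i* b)%C *: w + v)) =
      a * P ('i%C *: w) - b * P w + P ('i%C *: v).
    by rewrite scalerDr PD scalerA mulrC -scalerA cw iiw mulrN.
  rewrite e1 e2; apply/eqP; rewrite eq_complex /=.
  by apply/andP; split; apply/eqP; ring.
have Re_adj (w : 'B(H)) h :
    complex.Re (inner (adjoint w h) h) = complex.Re (inner (w h) h).
  by rewrite adjointPr innerC Re_conjC.
have Padj w : P (adjoint w) = P w.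
  apply/eqP; rewrite -subr_eq0 -PN -PD; apply/eqP/Pskew => h.
  by rewrite blinE_D blinE_N innerDl innerNl ReD ReN Re_adj subrr.
have P1 : P blin_id = 1.
  apply/eqP; rewrite eq_le; apply/andP; split.
    by apply/P_le/upper_nil => h; rewrite inner_rnorm mul1r.
  rewrite -lerN2 -PN; apply/P_le/upper_nil => h.
  by rewrite blinE_N innerNl ReN inner_rnorm mulN1r.
exists phi; split; first split=> //.
- move=> w; rewrite /phi conjC_conjc /= Padj; congr (_ +i* _)%C.
  have -> : 'i%C *: adjoint w = - adjoint ('i%C *: w).
    rewrite adjointZ -scaleNr; congr (_ *: _).
    by rewrite conjC_conjc; apply/eqP; rewrite eq_complex /= oppr0 opprK !eqxx.
  by rewrite PN Padj opprK.
- rewrite /phi; have -> : P ('i%C *: blin_id) = 0; last by rewrite P1 oppr0.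
  by apply: Pskew => h; rewrite blinE_Z innerZl inner_rnorm mulrC Re_scale mulr0.
move=> x y; rewrite /=; set z := T x y.
set a := P _; set b := P _.
have a0 : 0 <= a.
  by apply: Ppos => h; rewrite /= adjointP inner_rnorm /= exprn_ge0 ?rnorm_ge0.
have b0 : 0 <= b.
  by apply: Ppos => h; rewrite /= adjointPr inner_rnorm /= exprn_ge0 ?rnorm_ge0.
have key (l : R[i]) : complex.Re (l * z) <= 2^-1 * (cabs l ^+ 2 * a + b).
  pose w : 'B(H) := (cabs l ^+ 2)%:C%C *: (val x ∘ adjoint (val x)) +
    adjoint (val y) ∘ val y.
  have : P (- (2^-1%:C%C *: w)) <= - complex.Re (l * z).
    apply: P_le; exists [:: (l *: x, y)] => h.
    rewrite blinE_N blinE_Z innerNl innerZl ReN Re_scale /tau /col !big_cons !big_nil !addr0 /=.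
    have -> : complex.Re (T (l *: x) y) = complex.Re (l * z).
      by rewrite linearZl_LR.
    rewrite addNr mul0r.
    have -> : complex.Re (inner (w h) h) = col_sqr (l *: x) y h.
      have i1 : inner ((val x ∘ adjoint (val x)) h) h =
          (rnorm (adjoint (val x) h) ^+ 2)%:C%C.
        by rewrite /= adjointP inner_rnorm.
      have i2 : inner ((adjoint (val y) ∘ val y) h) h = (rnorm (val y h) ^+ 2)%:C%C.
        by rewrite /= adjointPr inner_rnorm.
      rewrite blinE_D blinE_Z innerDl innerZl i1 i2 ReD Re_scale /= /col_sqr.
      have -> : val (l *: x) = l *: val x by exact: linearZ.
      by rewrite adjointZ blinE_Z rnormZ_cabs cabsJ exprMn.
    by rewrite addNr.
  by rewrite PN PZ PD PZ -/a -/b lerN2.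
have [->|z0] := eqVneq (cabs z) 0; first by rewrite expr0n mulr_ge0.
have z2 : 0 < cabs z ^+ 2 by rewrite exprn_gt0// lt0r z0 cabs_ge0.
(* the choice [l = t z^*] makes [l z] real, and the discriminant in [t] turns the
   arithmetic mean into the geometric one *)
have step (t : R) : 0 <= b + t * (- cabs z ^+ 2) *+ 2 + t ^+ 2 * (cabs z ^+ 2 * a).
  have := key (t%:C%C * z^*).
  rewrite -mulrA Re_scale [z^* * z]mulrC mul_conj_cabs /= cabsM cabs_real cabsJ.
  by rewrite exprMn real_normK ?num_real//; lra.
have := quad_discr (mulr_ge0 (sqr_ge0 _) a0) step.
by rewrite sqrrN (mulrCA b) (expr2 (cabs z ^+ 2)) ler_pM2l// mulrC.
Qed.

End Dominating.

(** * The Gelfand-Naimark-Segal representation *)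

Section CompTheory.
Variables (R : realType) (U V W X : normedModType R[i]).

Lemma comp_linr (f : blin V W) a (g h : blin U V) :
  f ∘ (a *: g + h) = a *: (f ∘ g) + f ∘ h.
Proof. by apply: blin_ext => x; rewrite /= blin_linear. Qed.

Lemma comp_linl a (f g : blin V W) (h : blin U V) :
  (a *: f + g) ∘ h = a *: (f ∘ h) + g ∘ h.
Proof. exact: blin_ext. Qed.

Lemma comp_assoc (f : blin W X) (g : blin V W) (h : blin U V) :
  f ∘ (g ∘ h) = f ∘ g ∘ h.
Proof. exact: blin_ext. Qed.

End CompTheory.

Lemma mk_linear (R : nzRingType) (U V : lmodType R) (f : U -> V) :
  linear f -> exists g : {linear U -> V}, g =1 f.
Proof.
move=> lf; pose g : {linear U -> V} :=
  HB.pack f (GRing.isLinear.Build R U V *:%R f lf).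
by exists g.
Qed.

Section GNS.
Variables (R : realType) (H : hilbertType R) (phi : 'B(H) -> R[i]).
Hypothesis phiP : unital_positive phi.

Lemma comp_id (w : 'B(H)) : w ∘ blin_id H = w. Proof. exact: blin_ext. Qed.

Lemma gns_scalar y : scalar ((fun x y : 'B(H) => phi (adjoint y ∘ x))^~ y).
Proof. by have [phil _ _ _] := phiP; move=> a x z; rewrite comp_linr phil. Qed.

Lemma gns_conj (x y : 'B(H)) : phi (adjoint y ∘ x) = (phi (adjoint x ∘ y))^*.
Proof.
by have [_ phia _ _] := phiP; rewrite -phia adjoint_comp adjointK.
Qed.

Lemma gns_ge0 (x : 'B(H)) : 0 <= phi (adjoint x ∘ x).
Proof.
have [_ _ phi0 _] := phiP.
have Cr : phi (adjoint x ∘ x) \is Num.real by apply/CrealP; rewrite -gns_conj.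
rewrite -(RRe_real Cr) ler0c phi0// => h.
by rewrite /= adjointPr inner_rnorm /= exprn_ge0 ?rnorm_ge0.
Qed.

Definition gns_sip : semi_inner 'B(H) := SemiInner gns_scalar gns_conj gns_ge0.

Local Notation K := (completion gns_sip).

(** The operator [|a|^2 y^* y - y^* a^* a y] has a positive numerical range. *)
Lemma gns_snorm_comp (a y : 'B(H)) :
  snorm gns_sip (a ∘ y) <= rnorm a * snorm gns_sip y.
Proof.
have [phil _ phi0 _] := phiP.
rewrite -(@ler_pXn2r _ 2) ?nnegrE ?mulr_ge0 ?snorm_ge0 ?rnorm_ge0//.
rewrite exprMn !snorm_sqr /=.
pose w := (rnorm a ^+ 2)%:C%C *: (adjoint y ∘ y) + - (adjoint (a ∘ y) ∘ (a ∘ y)).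
have : 0 <= complex.Re (phi w).
  apply: phi0 => h; rewrite /w blinE_D blinE_Z blinE_N innerDl innerZl innerNl.
  have -> : inner ((adjoint y ∘ y) h) h = (rnorm (y h) ^+ 2)%:C%C.
    by rewrite /= adjointPr inner_rnorm.
  have -> : inner ((adjoint (a ∘ y) ∘ (a ∘ y)) h) h = (rnorm (a (y h)) ^+ 2)%:C%C.
    by rewrite [X in inner X _]/(adjoint (a ∘ y) ((a ∘ y) h)) adjointPr inner_rnorm.
  rewrite ReD ReN Re_scale /= subr_ge0 -exprMn.
  by rewrite ler_pXn2r ?nnegrE ?mulr_ge0 ?rnorm_ge0 ?rnorm_blin_le.
rewrite /w phil -[- _]scaleN1r -[_ *: (adjoint _ ∘ _)]addr0 phil.
have -> : phi 0 = 0 by have := phil (-1) 0 0; rewrite scaler0 addr0 mulN1r addNr.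
by rewrite addr0 mulN1r ReD ReN Re_scale subr_ge0.
Qed.

Lemma gns_fun_subproof (a : 'B(H)) (f : K) :
  (fun y => f (adjoint a ∘ y)) \in bounded_conj gns_sip.
Proof.
apply: (@mk_completion _ _ _ _ (rnorm f * rnorm a)) => [|c x y|y].
- by rewrite mulr_ge0 ?rnorm_ge0.
- by rewrite comp_linr completion_lin.
rewrite (le_trans (le_rnorm_completion _ _))// -mulrA.
rewrite ler_wpM2l ?rnorm_ge0// (le_trans (gns_snorm_comp _ _))//.
by rewrite ler_wpM2r ?snorm_ge0 ?rnorm_adjoint_le.
Qed.

(** Transposing the multiplication by [a^*] extends [hat y |-> hat (a y)] to all
    functionals at once. *)
Definition gns_fun (a : 'B(H)) (f : K) : K := Completion (gns_fun_subproof a f).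

Lemma gns_funE a f y : gns_fun a f y = f (adjoint a ∘ y). Proof. by []. Qed.

Lemma gns_blin_subproof (a : 'B(H)) : gns_fun a \in @bounded_linear R K K.
Proof.
apply/asboolP; split=> [c f g|]; first exact: completion_ext.
exists (rnorm a) => f; apply: rnorm_completion_le => [|y].
  by rewrite mulr_ge0 ?rnorm_ge0.
rewrite gns_funE (le_trans (le_rnorm_completion _ _))// [leRHS]mulrAC mulrC.
rewrite ler_wpM2r ?rnorm_ge0// (le_trans (gns_snorm_comp _ _))//.
by rewrite ler_wpM2r ?snorm_ge0 ?rnorm_adjoint_le.
Qed.

Definition gns_blin a : 'B(K) := Blin (gns_blin_subproof a).

Lemma gns_blinE a (f : K) y : gns_blin a f y = f (adjoint a ∘ y).
Proof. by []. Qed.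

Lemma gns_hat a x : gns_blin a (hat gns_sip x) = hat gns_sip (a ∘ x).
Proof.
apply: completion_ext => y; rewrite gns_blinE !hatE /=.
by rewrite adjoint_comp adjointK -comp_assoc.
Qed.

Lemma blin_ext_hat (f g : 'B(K)) :
  (forall x, f (hat gns_sip x) = g (hat gns_sip x)) -> f = g.
Proof.
move=> fg; apply: blin_ext => k; apply/eqP; rewrite -subr_eq0; apply/eqP.
rewrite -blinE_N -blinE_D; apply/rnorm_eq0/eqP.
rewrite eq_le rnorm_ge0 andbT; apply/ler_addgt0Pr => e e0; rewrite add0r.
have e1 : 0 < e / (rnorm (f - g) + 1).
  by rewrite divr_gt0// ltr_wpDl// rnorm_ge0.
have [x] := hat_dense k e1; rewrite ler_pdivlMr ?ltr_wpDl ?rnorm_ge0// => xe.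
have fg0 : (f - g) (hat gns_sip x) = 0 by rewrite blinE_D blinE_N fg subrr.
rewrite -[k](subrK (hat gns_sip x)) blinD fg0 addr0.
rewrite (le_trans (rnorm_blin_le _ _))// mulrC (le_trans _ xe)//.
by rewrite ler_wpM2l ?rnorm_ge0// lerDl.
Qed.

Lemma gns_adjoint a : gns_blin (adjoint a) = adjoint (gns_blin a).
Proof.
apply: blin_ext_hat => x; rewrite gns_hat; apply: inner_ext => f.
by rewrite -adjointP !inner_hat gns_blinE.
Qed.

Lemma gns_comp a b : gns_blin (a ∘ b) = gns_blin a ∘ gns_blin b.
Proof. apply: blin_ext_hat => x.
transitivity (gns_blin a (gns_blin b (hat gns_sip x))); last by [].
by rewrite !gns_hat comp_assoc. Qed.

Lemma gns_linear : linear gns_blin.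
Proof.
move=> c a b; apply: blin_ext_hat => x; rewrite blinE_D blinE_Z !gns_hat.
by rewrite comp_linl hat_lin.
Qed.

Definition gns_xi : K := hat gns_sip (blin_id H).

Lemma gns_xi_norm : rnorm gns_xi = 1.
Proof.
have [_ _ _ phi1] := phiP.
rewrite rnorm_hat /snorm /= comp_id.
have -> : adjoint (blin_id H) = blin_id H by apply: adjoint_unique.
by rewrite phi1 /= sqrtr1.
Qed.

Lemma gns_cyclic a : gns_blin a gns_xi = hat gns_sip a.
Proof. by rewrite gns_hat comp_id. Qed.

Variables (A : submodClosed 'B(H)) (T : {biscalar (subspace_of A)}).

Definition gns_rep (x : Cstar A) : 'B(K) := gns_blin (val x).

Lemma gns_rep_linear : linear gns_rep.
Proof. by move=> c x y; rewrite /gns_rep linearP gns_linear. Qed.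

HB.instance Definition _ :=
  GRing.isLinear.Build R[i] (Cstar A) 'B(K) *:%R gns_rep gns_rep_linear.

Hypothesis Tphi : forall x y : subspace_of A, cabs (T x y) ^+ 2 <=
    complex.Re (phi (val x ∘ adjoint (val x))) *
    complex.Re (phi (adjoint (val y) ∘ val y)).

Local Notation hatA y := (hat gns_sip (val y)).

Let Tbound x y : cabs (T x y) <=
  rnorm (hatA y) * rnorm (hat gns_sip (adjoint (val x))).
Proof.
rewrite -(@ler_pXn2r _ 2) ?nnegrE ?mulr_ge0 ?rnorm_ge0 ?cabs_ge0//.
rewrite (le_trans (Tphi x y))// exprMn !rnorm_hat !snorm_sqr /= adjointK.
by rewrite mulrC.
Qed.

(** [T x y] is a contractive sesquilinear form in the classes of [y] and [x^*].
    Representing it by a vector for each [y], and then the functional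
    [y |-> (B y | k)] by a vector for each [k], extends it to the whole space. *)
Lemma gns_contraction : exists2 b : 'B(K), rnorm b <= 1 &
  forall x y, T x y = inner (b (hatA y)) (hat gns_sip (adjoint (val x))).
Proof.
pose G : set 'B(H) := [set z | adjoint z \in A].
have G0 : G 0 by rewrite /G /= adjoint0 rpred0.
have GP a x y : G x -> G y -> G (a *: x + y).
  by move=> Gx Gy; rewrite /G /= adjoint_lin rpredD// rpredZ.
pose op (z : 'B(H)) : subspace_of A := insubd 0 (adjoint z).
have val_op z : G z -> val (op z) = adjoint z by move=> Gz; rewrite insubdK.
have op_lin a x z : G x -> G z -> op (a *: x + z) = a^* *: op x + op z.
  move=> Gx Gz; apply: val_inj; rewrite val_op; last exact: GP.
  rewrite adjoint_lin -(val_op _ Gx) -(val_op _ Gz).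
  by rewrite [RHS]linearP.
have [||||B [lB BN BE]] := @riesz_family _ _ _ (hat gns_sip) G
    (@hat_lin _ _ gns_sip) G0 GP _ (fun y z => (T (op z) y)^*)
    (fun y => rnorm (hatA y)).
- by move=> y; exact: rnorm_ge0.
- move=> y a x z Gx Gz; rewrite op_lin// linearPl rmorphD rmorphM /=.
  by rewrite conjCK.
- by move=> z a y w _; rewrite linearPr rmorphD rmorphM.
- move=> y z Gz; rewrite cabsJ (le_trans (Tbound _ _))// val_op// adjointK.
  exact: lexx.
have lA : linear (fun y : subspace_of A => hatA y).
  by move=> a x y; rewrite linearP hat_lin.
(* the adjoint of the contraction [C] will be the extension of [B] *)
have [||||C [lC CN CE]] := @riesz_family _ _ _ (fun y : subspace_of A => hatA y)
    setT lA I (fun _ _ _ _ _ => I) K (fun k y => inner (B y) k) (@rnorm R K).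
- by move=> k; exact: rnorm_ge0.
- by move=> k a x y _ _; rewrite lB innerPl.
- by move=> y a k l _; rewrite innerPr.
- move=> k y _; rewrite (le_trans (inner_le _ _))// mulrC.
  by rewrite ler_wpM2l ?rnorm_ge0 ?BN.
have CN1 k : rnorm (C k) <= 1 * rnorm k by rewrite mul1r CN.
have [c cC] := mk_blin lC CN1.
exists (adjoint c) => [|x y].
  rewrite (le_trans (rnorm_adjoint_le _))//.
  by apply: rnorm_blin_ge => // k; rewrite cC CN1.
have Gx : G (adjoint (val x)) by rewrite /G /= adjointK; exact: valP.
rewrite adjointPr cC -CE// innerC -BE// conjCK; congr (T _ y).
by apply: val_inj; rewrite val_op// adjointK.
Qed.

Lemma gns_represents : exists (K : hilbertType R)
    (pi : {linear Cstar A -> 'B(K)}) (xi : K) (b : 'B(K)),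
  [/\ star_representation pi, `|xi| = 1, `|b| <= 1 &
    forall x y : subspace_of A,
      T x y = inner (pi (to_Cstar x) (b (pi (to_Cstar y) xi))) xi].
Proof.
have [b b1 Tb] := gns_contraction.
have repP : star_representation gns_rep.
  by split=> [x y|x]; [exact: gns_comp|exact: gns_adjoint].
have repE x : gns_rep x gns_xi = hat gns_sip (val x) by exact: gns_cyclic.
have TE (x y : subspace_of A) :
    T x y = inner (gns_rep (to_Cstar x) (b (gns_rep (to_Cstar y) gns_xi))) gns_xi.
  by rewrite adjointP -(repP.2 (to_Cstar x)) !repE Tb.
have xi1 : `|gns_xi| = 1 by rewrite rnormE gns_xi_norm.
have b1' : `|b| <= 1 by rewrite rnormE -[leRHS]/(1%:C%C) lecR.
exists K, gns_rep, gns_xi, b.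
exact: And4 repP xi1 b1' TE.
Qed.

End GNS.

(** * States, representations and column factorizations *)

Section CbNorm.
Variables (R : realType) (V W : Type).
Variables (nV : forall n, 'M[V]_n -> R) (nW : forall n, 'M[W]_n -> R).
Variable f : V -> W.

Lemma cbnorm_le (M : R) : 0 <= M ->
  (forall n (X : 'M[V]_n), nW (map_mx f X) <= M * nV X) -> cbnorm nV nW f <= M.
Proof.
move=> M0 fM; rewrite /cbnorm; set S := [set _ | _].
have [[Sn0 _]|/sup_out ->//] := pselect (has_sup S).
by apply: ge_sup => // _ [n [X [X1 ->]]]; rewrite (le_trans (fM n X))// ler_piMr.
Qed.

Hypothesis nV0 : forall n (X : 'M[V]_n), 0 <= nV X.
Hypothesis nW0 : forall n (X : 'M[W]_n), 0 <= nW X.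

Lemma cbnorm_ge0 : 0 <= cbnorm nV nW f.
Proof.
rewrite /cbnorm; set S := [set _ | _].
have [hS|/sup_out ->//] := pselect (has_sup S).
have [[r Sr] _] := hS; have [n [X [X1 rE]]] := Sr.
by apply: (le_trans (nW0 (map_mx f X))); apply: sup_upper_bound => //; rewrite -rE.
Qed.

Lemma le_cbnorm n (X : 'M[V]_n) : completely_bounded nV nW f -> nV X <= 1 ->
  nW (map_mx f X) <= cbnorm nV nW f.
Proof.
move=> [M fM] X1; apply: sup_upper_bound; last by exists n, X.
split; first by exists (nW (map_mx f X)), n, X.
exists `|M| => _ [m [Y [Y1 ->]]]; rewrite (le_trans (fM m Y))//.
rewrite (le_trans (ler_norm _))// normrM (ger0_norm (nV0 Y)).
by rewrite ler_piMr.
Qed.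

End CbNorm.

Lemma le_half_sum (R : realFieldType) (t u v : R) : 0 <= t -> 0 <= u -> 0 <= v ->
  t ^+ 2 <= u * v -> t <= 2^-1 * (u + v).
Proof.
move=> t0 u0 v0 tuv.
rewrite -(@ler_pXn2r _ 2) ?nnegrE ?mulr_ge0 ?addr_ge0// (le_trans tuv)//.
have -> : (2^-1 * (u + v)) ^+ 2 = u * v + (2^-1 * (u - v)) ^+ 2 by field.
by rewrite lerDl sqr_ge0.
Qed.

Section Main.
Variables (R : realType) (H : hilbertType R) (A : submodClosed 'B(H)).
Local Notation V := (subspace_of A).
Local Notation C := (Cstar A).

Lemma cadj_lin a (x y : C) : cadj (a *: x + y) = a^* *: cadj x + cadj y.
Proof. by apply: val_inj; exact: adjoint_lin. Qed.

Lemma cadjK (x : C) : cadj (cadj x) = x.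
Proof. by apply: val_inj; rewrite /= adjointK. Qed.

Lemma rnorm_cadj (x : C) : rnorm (cadj x) <= rnorm x.
Proof. exact: rnorm_adjoint_le. Qed.

(** The arithmetic mean bounds each geometric mean, and a state is at most the norm
    on the sum of the [x_i x_i^* + y_i^* y_i]. *)
Lemma dominated_of_state (T : {biscalar V}) (p : dual C) : state p ->
    (forall x y : V, `|T x y| <= sqrtC (p (cmul (to_Cstar x) (cadj (to_Cstar x)))) *
                  sqrtC (p (cmul (cadj (to_Cstar y)) (to_Cstar y)))) ->
  wh_dominated T.
Proof.
move=> [p0 p1] Tp n x y c c0 xyc.
pose a i := p (cmul (to_Cstar (x i)) (cadj (to_Cstar (x i)))).
pose b i := p (cmul (cadj (to_Cstar (y i))) (to_Cstar (y i))).
have a0 i : 0 <= a i by have := p0 (cadj (to_Cstar (x i))); rewrite cadjK.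
have b0 i : 0 <= b i by exact: p0.
have Tab i : cabs (T (x i) (y i)) <= 2^-1 * (complex.Re (a i) + complex.Re (b i)).
  have := Tp (x i) (y i); rewrite -/(a i) -/(b i) cabsE => h.
  have h2 : (cabs (T (x i) (y i)) ^+ 2)%:C%C <= a i * b i :> R[i].
    rewrite -[a i]sqrtCK -[b i]sqrtCK -exprMn rmorphXn /=.
    by rewrite ler_pXn2r// nnegrE ?mulr_ge0 ?sqrtC_ge0// ler0c cabs_ge0.
  apply: le_half_sum; rewrite ?Re_ge0 ?cabs_ge0// -lecR [leRHS]rmorphM /=.
  by rewrite -(ge0_Re (a0 i)) -(ge0_Re (b0 i)).
pose w : C := \sum_i (cmul (to_Cstar (x i)) (cadj (to_Cstar (x i))) +
                      cmul (cadj (to_Cstar (y i))) (to_Cstar (y i))).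
have pw : p w = \sum_i (a i + b i).
  by rewrite blin_sum; apply: eq_bigr => i _; rewrite blinD.
have wc : rnorm w <= 2 * c.
  pose r := [seq adjoint (val (x i)) | i <- index_enum 'I_n] ++
            [seq val (y i) | i <- index_enum 'I_n].
  have -> : rnorm w = rnorm (\sum_(z <- r) adjoint z ∘ z).
    rewrite -[LHS]/(rnorm (val w)) val_sumC /r big_cat !big_map /= -big_split.
    by congr rnorm; apply: eq_bigr => i _; rewrite adjointK.
  apply: (rnorm_gram_le (c := fun z => z)) => [|h]; first by rewrite mulr_ge0.
  by rewrite /r big_cat !big_map /= -big_split; exact: xyc.
apply: (@le_trans _ _ (\sum_i 2^-1 * (complex.Re (a i) + complex.Re (b i)))).
  elim/big_rec2: _ => [|i u v _ uv]; first by rewrite cabs0.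
  by rewrite (le_trans (cabsD _ _))// lerD.
rewrite -mulr_sumr ler_pdivrMl//.
under eq_bigr do rewrite -ReD.
rewrite -Re_sum -pw (le_trans (Re_le_cabs _))//.
rewrite (le_trans (rnorm_blin_le p w))// (le_trans _ wc)//.
by rewrite [rnorm p]/rnorm p1 mul1r.
Qed.

(** The Cauchy-Schwarz inequality against the identity gives the norm bound. *)
Lemma restrict_positive (phi : 'B(H) -> R[i]) : unital_positive phi ->
  exists p : dual C, (forall x : C, p x = phi (val x)) /\ rnorm p <= 1.
Proof.
move=> phiP; have [phil _ _ phi1] := phiP.
have pb (x : C) : cabs (phi (val x)) <= 1 * rnorm x.
  have := cauchy_schwarz (gns_sip phiP) (val x) (blin_id H).
  have s1 : snorm (gns_sip phiP) (blin_id H) = 1.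
    by rewrite -rnorm_hat; exact: gns_xi_norm.
  have := gns_snorm_comp phiP (val x) (blin_id H).
  rewrite s1 comp_id /= => h1; rewrite mulr1 mul1r.
  have -> : adjoint (blin_id H) = blin_id H by apply: adjoint_unique.
  have -> : blin_id H ∘ val x = val x by exact: blin_ext.
  by move=> /le_trans; apply; rewrite mulr1 in h1.
have pl : linear (fun x : C => phi (val x) : R[i]^o).
  by move=> a x y; rewrite linearP phil.
have [p pE] := mk_blin pl pb.
exists p; split=> //; apply: rnorm_blin_ge => // x; rewrite pE; exact: pb.
Qed.

Lemma normalize_positive (p : dual C) : (forall x, 0 <= p (cmul (cadj x) x)) ->
  rnorm p != 0 -> state ((rnorm p)^-1%:C%C *: p).
Proof.
move=> p0 pn0; split=> [x|].
  by rewrite blinE_Z mulr_ge0 ?p0// ler0c invr_ge0 rnorm_ge0.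
rewrite normrZ (rnormE p) cabsE cabs_real -rmorphM.
by rewrite ger0_norm ?invr_ge0 ?rnorm_ge0// mulVf.
Qed.

Lemma exists_nonzero : (exists2 x : 'B(H), x \in A & x != 0) ->
  exists h : H, h != 0.
Proof.
move=> [x0 _ /eqP x0_neq0]; apply: contrapT => H0.
apply: x0_neq0; apply: blin_ext => h; have -> : h = 0; last by rewrite !blin0.
by apply/eqP; apply: contrapT => /negP hx; apply: H0; exists h.
Qed.

(** A normalized vector functional, for a vector not annihilated by [A]. *)
Lemma exists_state : (exists2 x : 'B(H), x \in A & x != 0) ->
  exists p : dual C, state p.
Proof.
move=> [x0 Ax0 x0_neq0].
have [h x0h] : exists h, x0 h != 0.
  apply: contrapT => x0h; move/eqP: x0_neq0; apply; apply: blin_ext => h.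
  by apply/eqP; apply: contrapT => /negP hx; apply: x0h; exists h.
have ol : linear (fun x : C => inner (val x h) h : R[i]^o).
  by move=> a x y; rewrite linearP blinE_D blinE_Z innerPl.
have ob (x : C) : cabs (inner (val x h) h) <= rnorm h ^+ 2 * rnorm x.
  rewrite (le_trans (inner_le _ _))// expr2 -mulrA mulrC ler_wpM2l ?rnorm_ge0//.
  by rewrite mulrC rnorm_blin_le.
have [p pE] := mk_blin ol ob.
have pxx (x : C) : p (cmul (cadj x) x) = (rnorm (val x h) ^+ 2)%:C%C.
  by rewrite pE /= adjointPr inner_rnorm.
exists ((rnorm p)^-1%:C%C *: p); apply: normalize_positive => [x|].
  by rewrite pxx ler0c exprn_ge0 ?rnorm_ge0.
apply/negP => /eqP/rnorm_eq0 p0; move/eqP: x0h; apply; apply: rnorm_eq0.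
pose X : C := to_Cstar (exist (fun z => z \in A) x0 Ax0).
have := pxx X; rewrite p0 blinE_0 => /esym/complexI/eqP.
by rewrite sqrf_eq0 => /eqP.
Qed.

(** Normalizing [p] can only increase it on positive elements. When [p] is zero
    any state will do. *)
Lemma le_state (p : dual C) : (exists q : dual C, state q) ->
    (forall x, 0 <= p (cmul (cadj x) x)) -> rnorm p <= 1 ->
  exists2 q : dual C, state q &
    forall x, complex.Re (p (cmul (cadj x) x)) <= complex.Re (q (cmul (cadj x) x)).
Proof.
move=> [q0 sq0] p0 p1; have [pn0|pn0] := eqVneq (rnorm p) 0.
  exists q0 => // x; rewrite (rnorm_eq0 pn0) blinE_0 /=.
  by apply: Re_ge0; exact: sq0.1.
exists ((rnorm p)^-1%:C%C *: p); first exact: normalize_positive.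
move=> x; rewrite blinE_Z Re_scale ler_peMl ?Re_ge0 ?p0//.
by rewrite invf_ge1// lt0r pn0 rnorm_ge0.
Qed.

Lemma state_of_dominated (T : {biscalar V}) :
    (exists2 x : 'B(H), x \in A & x != 0) -> wh_dominated T ->
  exists2 p : dual C, state p & forall x y : V,
    `|T x y| <= sqrtC (p (cmul (to_Cstar x) (cadj (to_Cstar x)))) *
                sqrtC (p (cmul (cadj (to_Cstar y)) (to_Cstar y))).
Proof.
move=> A0 Tdom; have [h h0] := exists_nonzero A0.
have [phi [phiP Tphi]] := dominating_functional Tdom h0.
have [r [rE r1]] := restrict_positive phiP.
have r0 x : 0 <= r (cmul (cadj x) x) by rewrite rE; exact: (gns_ge0 phiP).
have [p ps rp] := le_state (exists_state A0) r0 r1.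
exists p => // x y; set a := p _; set b := p _.
have a0 : 0 <= a by have := ps.1 (cadj (to_Cstar x)); rewrite cadjK.
have b0 : 0 <= b by exact: ps.1.
rewrite -(@ler_pXn2r _ 2) ?nnegrE ?mulr_ge0 ?sqrtC_ge0//.
rewrite exprMn !sqrtCK cabsE -rmorphXn /=.
rewrite (ge0_Re a0) (ge0_Re b0) -rmorphM lecR (le_trans (Tphi x y))//.
have px := rp (cadj (to_Cstar x)); rewrite cadjK rE in px.
have py := rp (to_Cstar y); rewrite rE in py.
have r0x := r0 (cadj (to_Cstar x)); rewrite cadjK rE in r0x.
have r0y := r0 (to_Cstar y); rewrite rE in r0y.
by apply: ler_pM => //; exact: Re_ge0.
Qed.

Definition column_factorization (T : {biscalar V}) :=
  exists (T' : {linear C -> dual C}) (K : hilbertType R)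
         (a : {linear C -> K}) (b : {linear K -> K}),
    [/\ extension T T',
        completely_bounded (@submx_norm R H (Cstar_pred A)) (@column_norm R K) a,
        completely_bounded (@column_norm R K) (@column_norm R K) b,
        forall y, T' y = column_adjoint a (b (a y)) :> (C -> R[i]) &
        cbnorm (@submx_norm R H (Cstar_pred A)) (@column_norm R K) a ^+ 2 *
        cbnorm (@column_norm R K) (@column_norm R K) b <= 1].

Lemma submx_norm_ge0 n (X : 'M[C]_n) : 0 <= submx_norm X.
Proof. exact: map_norm_ge0. Qed.

(** Applied to a scalar vector [l], a matrix [X] becomes the column of the
    [sum_j l_j X_ij], on which the representation is contractive. *)
Lemma orbit_column_norm (K : hilbertType R) (pi : {linear C -> 'B(K)}) (xi : K) n
    (X : 'M[C]_n) : star_representation pi -> rnorm xi = 1 ->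
  column_norm (map_mx (fun x => pi x xi) X) <= 1 * submx_norm X.
Proof.
move=> piP xi1; rewrite mul1r; apply: map_norm_le => [|l]; first exact: submx_norm_ge0.
rewrite l2norm_le ?mulr_ge0 ?submx_norm_ge0 ?l2norm_ge0//.
pose z i : C := \sum_j (l j : R[i]) *: X i j.
have -> : \sum_i rnorm (\sum_j l j *: map_mx (fun x => pi x xi) X i j) ^+ 2 =
    \sum_i rnorm (pi (z i) xi) ^+ 2.
  apply: eq_bigr => i _; congr (rnorm _ ^+ 2); rewrite linear_sum blinE_sum.
  by apply: eq_bigr => j _; rewrite mxE linearZ blinE_Z.
rewrite -[leRHS]mulr1 -[X in _ * X](expr1n _ 2) -xi1.
apply: (rep_column_contractive piP) => [|h]; first exact: sqr_ge0.
have := le_opmx_norm (map_mx val X) (fun j => (l j : R[i]) *: h).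
rewrite l2norm_le ?mulr_ge0 ?opmx_norm_ge0 ?l2norm_ge0// => Xh.
have zE i : val (z i) h = \sum_j map_mx val X i j ((l j : R[i]) *: h).
  rewrite val_sumC blinE_sum; apply: eq_bigr => j _.
  have -> : val (l j *: X i j) = (l j : R[i]) *: val (X i j) by exact: linearZ.
  by rewrite mxE blinZ blinE_Z.
under eq_bigr do rewrite zE.
have lh : l2norm (fun j => (l j : R[i]) *: h) ^+ 2 = l2norm l ^+ 2 * rnorm h ^+ 2.
  rewrite !l2norm_sqr mulr_suml; apply: eq_bigr => j _.
  by rewrite rnormZ_cabs exprMn.
by rewrite (le_trans Xh)// exprMn lh exprMn (mulrA (submx_norm X ^+ 2)).
Qed.

Lemma blin_column_norm (K : hilbertType R) (b : 'B(K)) n (X : 'M[K]_n) :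
  rnorm b <= 1 -> column_norm (map_mx b X) <= 1 * column_norm X.
Proof.
move=> b1; rewrite mul1r; apply: map_norm_le => [|l]; first exact: column_norm_ge0.
apply: le_trans (le_column_norm X l).
rewrite l2norm_le ?l2norm_ge0// l2norm_sqr; apply: ler_sum => i _.
have -> : \sum_j l j *: map_mx b X i j = b (\sum_j l j *: X i j).
  by rewrite blin_sum; apply: eq_bigr => j _; rewrite mxE blinZ.
rewrite ler_pXn2r ?nnegrE ?rnorm_ge0// (le_trans (rnorm_blin_le _ _))//.
by rewrite ler_piMl ?rnorm_ge0.
Qed.

(** The map [a y = pi y xi] factors the form, as
    [(pi x (b (pi y xi)) | xi) = (b (a y) | a (x^* ))]. *)
Lemma factorization_of_representation (T : {biscalar V}) (K : hilbertType R)
    (pi : {linear C -> 'B(K)}) (xi : K) (b : 'B(K)) :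
    star_representation pi -> `|xi| = 1 -> `|b| <= 1 ->
    (forall x y : V, T x y = inner (pi (to_Cstar x) (b (pi (to_Cstar y) xi))) xi) ->
  column_factorization T.
Proof.
move=> piP xi1 b1 TE.
have {}xi1 : rnorm xi = 1 by rewrite /rnorm xi1.
have {}b1 : rnorm b <= 1 by rewrite -lecR -rnormE.
have al : linear (fun x : C => pi x xi).
  by move=> c x y; rewrite linearP blinE_D blinE_Z.
have [a aE] := mk_linear al.
have aN x : rnorm (a x) <= rnorm x.
  by rewrite aE -[leRHS]mulr1 -xi1; exact: rep_contractive.
have [b' b'E] := mk_linear (blin_linear b).
have Tl (y : C) : linear (fun x : C => inner (b (a y)) (a (cadj x)) : R[i]^o).
  by move=> c u v; rewrite cadj_lin linearP innerPr conjCK.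
have Tb y (x : C) :
    cabs (inner (b (a y)) (a (cadj x))) <= rnorm (b (a y)) * rnorm x.
  rewrite (le_trans (inner_le _ _))// ler_wpM2l ?rnorm_ge0//.
  by rewrite (le_trans (aN _))// rnorm_cadj.
have [T0 T0E] := choice (fun y => mk_blin (Tl y) (Tb y)).
have T0l : linear T0.
  move=> c y z; apply: blin_ext => x; rewrite blinE_D blinE_Z !T0E.
  by rewrite linearP blin_linear innerPl.
have [T' T'E] := mk_linear T0l.
have acb n (X : 'M[C]_n) : column_norm (map_mx a X) <= 1 * submx_norm X.
  have -> : map_mx a X = map_mx (fun x => pi x xi) X.
    by apply/matrixP => i j; rewrite !mxE aE.
  exact: orbit_column_norm.
have bcb n (X : 'M[K]_n) : column_norm (map_mx b' X) <= 1 * column_norm X.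
  have -> : map_mx b' X = map_mx b X by apply/matrixP => i j; rewrite !mxE b'E.
  exact: blin_column_norm.
exists T', K, a, b'; split.
- move=> x y; rewrite T'E T0E TE (adjointP (pi (to_Cstar x))) -piP.2.
  by rewrite !aE.
- by exists 1.
- by exists 1.
- by move=> y; apply/funext => x; rewrite T'E T0E /column_adjoint b'E.
have a1 := cbnorm_le ler01 acb; have b1' := cbnorm_le ler01 bcb.
have a0 : 0 <= cbnorm (@submx_norm R H (Cstar_pred A)) (@column_norm R K) a.
  by apply: cbnorm_ge0 => n X; exact: column_norm_ge0.
have b0 : 0 <= cbnorm (@column_norm R K) (@column_norm R K) b'.
  by apply: cbnorm_ge0 => n X; exact: column_norm_ge0.
by rewrite mulr_ile1 ?exprn_ge0// exprn_ile1.
Qed.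

End Main.

Section ColumnFactorization.
Variables (R : realType) (H : hilbertType R) (A : submodClosed 'B(H)).
Local Notation V := (subspace_of A).
Local Notation C := (Cstar A).

(** Summing over a sequence placed in the first column of a square matrix; the
    additional last row is zero, so that the matrix is never empty. *)
Lemma sum_first_column (W : Type) (w0 : W) (F : W -> R) (s : seq W) : F w0 = 0 ->
  \sum_(i < (size s).+1) F (nth w0 s i) = \sum_(c <- s) F c.
Proof.
by move=> F0; rewrite big_ord_recr /= nth_default// F0 addr0 (big_nth w0) big_mkord.
Qed.

Lemma sum_ord0 (W : zmodType) n (F : 'I_n.+1 -> W) :
  (forall j, j != ord0 -> F j = 0) -> \sum_j F j = F ord0.
Proof. by move=> F0; rewrite (bigD1 ord0)//= big1 ?addr0. Qed.

(** Complete boundedness tested on a single column, normalized by [D]. *)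
Lemma cb_column_le (K : hilbertType R) (a : {linear C -> K}) (s : seq C) (D : R) :
    completely_bounded (@submx_norm R H (Cstar_pred A)) (@column_norm R K) a ->
    0 < D ->
    (forall h, \sum_(c <- s) rnorm (val c h) ^+ 2 <= D ^+ 2 * rnorm h ^+ 2) ->
  \sum_(c <- s) rnorm (a c) ^+ 2 <=
    (cbnorm (@submx_norm R H (Cstar_pred A)) (@column_norm R K) a * D) ^+ 2.
Proof.
move=> acb D0 sD; set al := cbnorm _ _ _.
have al0 : 0 <= al by apply: cbnorm_ge0 => n X; exact: column_norm_ge0.
pose d : R[i] := D^-1%:C%C.
have cd : cabs d = D^-1 by rewrite cabs_real ger0_norm// invr_ge0 ltW.
pose X : 'M[C]_((size s).+1) := \matrix_(i, j) if j == ord0 then d *: s`_i else 0.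
have val0 : val (0 : C) = 0 by [].
have valZ c (u : C) : val (c *: u) = c *: val u by exact: linearZ.
have X1 : submx_norm X <= 1.
  apply: map_norm_le => // h; rewrite mul1r l2norm_le ?l2norm_ge0//.
  have XE i : \sum_j map_mx val X i j (h j) = d *: val s`_i (h ord0).
    rewrite sum_ord0 => [|j j0]; first by rewrite !mxE eqxx valZ blinE_Z.
    by rewrite !mxE (negPf j0) val0 blinE_0.
  under eq_bigr do rewrite XE rnormZ_cabs exprMn cd.
  rewrite -mulr_sumr (sum_first_column (F := fun c : C => rnorm (val c (h ord0)) ^+ 2)); last first.
    by rewrite val0 blinE_0 rnorm0 expr0n.
  rewrite exprVn ler_pdivrMl ?exprn_gt0//.
  rewrite (le_trans (sD _))// ler_wpM2l ?sqr_ge0//.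
  by rewrite ler_pXn2r ?nnegrE ?rnorm_ge0 ?l2norm_ge0 ?rnorm_le_l2norm.
have aX := le_cbnorm (fun n X => submx_norm_ge0 X) acb X1.
pose l (j : 'I_(size s).+1) : R[i]^o := (j == ord0)%:R.
have l1 : l2norm l = 1.
  apply/eqP; rewrite -(@eqrXn2 _ 2) ?l2norm_ge0// l2norm_sqr sum_ord0.
    by rewrite /l eqxx /rnorm normr1 expr1n.
  by move=> j j0; rewrite /l (negPf j0) rnorm0 expr0n.
have := le_column_norm (map_mx a X) l; rewrite l1 mulr1 => h.
have {h} := le_trans h aX; rewrite l2norm_le//.
have XE i : \sum_j l j *: map_mx a X i j = d *: a s`_i.
  rewrite sum_ord0 => [|j j0]; last by rewrite /l (negPf j0) scale0r.
  by rewrite /l eqxx !mxE eqxx linearZ scale1r.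
under eq_bigr do rewrite XE rnormZ_cabs exprMn cd.
rewrite -mulr_sumr (sum_first_column (F := fun c : C => rnorm (a c) ^+ 2)); last first.
  by rewrite linear0 rnorm0 expr0n.
by rewrite exprVn ler_pdivrMl ?exprn_gt0// exprMn mulrC.
Qed.

Lemma cb_bounded_le (K : hilbertType R) (b : {linear K -> K}) (k : K) :
    completely_bounded (@column_norm R K) (@column_norm R K) b ->
  rnorm (b k) <= cbnorm (@column_norm R K) (@column_norm R K) b * rnorm k.
Proof.
move=> bcb; have [/rnorm_eq0 ->|k0] := eqVneq (rnorm k) 0.
  by rewrite linear0 rnorm0 mulr0.
have kgt0 : 0 < rnorm k by rewrite lt0r k0 rnorm_ge0.
pose d : R[i] := (rnorm k)^-1%:C%C.
have cd : cabs d = (rnorm k)^-1 by rewrite cabs_real ger0_norm// invr_ge0 ltW.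
pose X : 'M[K]_1 := const_mx (d *: k).
have X1 : column_norm X <= 1.
  apply: map_norm_le => // l; rewrite mul1r l2norm_le ?l2norm_ge0// l2norm_sqr.
  rewrite !big_ord1 mxE !rnormZ_cabs cd mulVf// mulr1.
  exact: lexx.
have bX := le_cbnorm (fun n X => column_norm_ge0 X) bcb X1.
have := le_column_norm (map_mx b X) (fun=> 1 : R[i]^o).
have -> : l2norm (fun _ : 'I_1 => 1 : R[i]^o) = 1.
  by rewrite /l2norm big_ord1 /rnorm normr1 expr1n sqrtr1.
rewrite mulr1 => /le_trans /(_ bX).
have := rnorm_le_l2norm (fun i : 'I_1 => \sum_j (1 : R[i]) *: map_mx b X i j) ord0.
move=> /le_trans h /h; rewrite big_ord1 !mxE scale1r linearZ rnormZ_cabs cd.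
by rewrite ler_pdivrMl// mulrC.
Qed.

(** Taking the [x_i^*] and the [y_i] as one column bounds the sum of all the
    [|a (x_i^* )|^2 + |a y_i|^2], and [2 r t <= r^2 + t^2] supplies the factor one
    half of the norm. *)
Lemma dominated_of_factorization (T : {biscalar V}) :
  column_factorization T -> wh_dominated T.
Proof.
move=> [T' [K [a [b [TT' acb bcb T'E ab1]]]]] n x y c c0 xyc.
set al := cbnorm _ _ a in ab1; set be := cbnorm _ _ b in ab1.
have al0 : 0 <= al by apply: cbnorm_ge0 => m X; exact: column_norm_ge0.
have be0 : 0 <= be by apply: cbnorm_ge0 => m X; exact: column_norm_ge0.
apply/ler_addgt0Pr => e e0; set c' := c + e.
have c'0 : 0 < c' by rewrite ltr_wpDl.
pose u i := a (cadj (to_Cstar (x i))); pose v i := a (to_Cstar (y i)).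
have Tuv i : T (x i) (y i) = inner (b (v i)) (u i).
  by rewrite -TT' T'E.
pose s := [seq cadj (to_Cstar (x i)) | i <- index_enum 'I_n] ++
          [seq to_Cstar (y i) | i <- index_enum 'I_n].
pose D := Num.sqrt (2 * c').
have D0 : 0 < D by rewrite sqrtr_gt0 mulr_gt0.
have DE : D ^+ 2 = 2 * c' by rewrite sqr_sqrtr// ltW// mulr_gt0.
have sD h : \sum_(z <- s) rnorm (val z h) ^+ 2 <= D ^+ 2 * rnorm h ^+ 2.
  rewrite /s big_cat !big_map /= -big_split DE (le_trans (xyc h))//.
  by rewrite ler_wpM2r ?exprn_ge0 ?rnorm_ge0// ler_wpM2l// lerDl ltW.
have := cb_column_le acb D0 sD.
rewrite -/al /s big_cat !big_map /= exprMn DE -big_split /= => sle.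
apply: (@le_trans _ _ (\sum_i be / 2 * (rnorm (u i) ^+ 2 + rnorm (v i) ^+ 2))).
  elim/big_rec2: _ => [|i p q _ pq]; first by rewrite cabs0.
  rewrite (le_trans (cabsD _ _))// lerD// Tuv (le_trans (inner_le _ _))//.
  rewrite (le_trans (ler_wpM2r (rnorm_ge0 _) (cb_bounded_le _ bcb)))// -/be.
  rewrite -!mulrA ler_wpM2l// mulrC.
  by apply: le_half_sum; rewrite ?mulr_ge0 ?sqr_ge0 ?rnorm_ge0// exprMn mulrC.
rewrite -mulr_sumr (le_trans (ler_wpM2l _ sle)) ?divr_ge0//.
have -> : be / 2 * (al ^+ 2 * (2 * c')) = (al ^+ 2 * be) * c' by field.
by rewrite ler_piMl// ltW.
Qed.

End ColumnFactorization.

Theorem theorem2p3 (R : realType) (H : hilbertType R)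
    (A : submodClosed 'B(H)) (A_neq0 : exists2 x : 'B(H), x \in A & x != 0)
    (T : {biscalar (subspace_of A)}) :
  [<->
       (wh_dual_norm T <= 1)%E ;
       exists2 p0 : dual (Cstar A), state p0 &
         forall x y : subspace_of A,
           `|T x y| <= sqrtC (p0 (cmul (to_Cstar x) (cadj (to_Cstar x)))) *
                       sqrtC (p0 (cmul (cadj (to_Cstar y)) (to_Cstar y))) ;
       exists (K : hilbertType R) (pi : {linear Cstar A -> 'B(K)}) (xi : K) (b : 'B(K)),
         [/\ star_representation pi, `|xi| = 1, `|b| <= 1 &
             forall x y : subspace_of A,
               T x y = inner (pi (to_Cstar x) (b (pi (to_Cstar y) xi))) xi] ;
       exists (T' : {linear Cstar A -> dual (Cstar A)}) (K : hilbertType R)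
              (a : {linear Cstar A -> K}) (b : {linear K -> K}),
         [/\ extension T T',
             completely_bounded (@submx_norm R H (Cstar_pred A))
                                (@column_norm R K) a,
             completely_bounded (@column_norm R K) (@column_norm R K) b,
             forall y, T' y = column_adjoint a (b (a y)) :> (Cstar A -> R[i]) &
             cbnorm (@submx_norm R H (Cstar_pred A)) (@column_norm R K) a ^+ 2 *
             cbnorm (@column_norm R K) (@column_norm R K) b <= 1] ].
Proof.
tfae.
- by move=> /wh_dualP; exact: state_of_dominated.
- move=> [p ps Tp]; have Tdom := dominated_of_state ps Tp.
  have [h h0] := exists_nonzero A_neq0.
  have [phi [phiP Tphi]] := dominating_functional Tdom h0.
  have [K [pi [xi [b repT]]]] := gns_represents phiP Tphi.
  by exists K, pi, xi, b; exact: repT.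
- move=> [K [pi [xi [b [piP xi1 b1 TE]]]]].
  exact: factorization_of_representation piP xi1 b1 TE.
- by move=> Tfac; apply/wh_dualP; exact: dominated_of_factorization.
Qed.
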